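(* Let $n$ be a positive integer and let $\dot z\in\mathbb{C}$ be nonzero. Then there is an isomorphism of associative algebras $$\phi_{\dot z}:\ U(\mathfrak{s}_n)/\langle z-\dot z\rangle\rightarrow U(\mathfrak{so}_n\oplus\mathfrak{sl}_2)\otimes\mathfrak{D}_n$$ defined by, for $1\leq i,j\leq n$, $$x_i\mapsto 1\otimes\tilde x_i,\qquad y_i\mapsto 1\otimes\tilde y_i,$$ $$e\mapsto e\otimes1+1\otimes\tilde e,\qquad f\mapsto f\otimes 1+1\otimes\tilde f,\qquad h\mapsto h\otimes1+1\otimes\tilde h,$$ $$s_{ij}\mapsto s_{ij}\otimes1+1\otimes\tilde s_{ij}.$$
   Context: For a positive integer $n$, the Schrödinger Lie algebra $\mathfrak{s}_n=(\mathfrak{sl}_2\oplus\mathfrak{so}_n)\ltimes\mathfrak{h}_n$ is the complex Lie algebra with basis $e,f,h$ (spanning $\mathfrak{sl}_2$), $s_{ij}$ for $1\leq i<j\leq n$ (spanning $\mathfrak{so}_n$, the skew-symmetric $n\times n$ matrices, with $s_{ij}$ corresponding to $e_{ij}-e_{ji}$), and $x_1,\dots,x_n,y_1,\dots,y_n,z$ (spanning the Heisenberg algebra $\mathfrak{h}_n$). Put $s_{ji}=-s_{ij}$, $s_{ii}=0$. The non-trivial brackets are $$[h,e]=2e,\ [h,f]=-2f,\ [e,f]=h,\quad [x_i,y_i]=z,\ [h,x_i]=x_i,\ [h,y_i]=-y_i,\quad [e,y_i]=x_i,\ [f,x_i]=y_i,$$ $$[s_{kl},x_i]=\delta_{li}x_k-\delta_{ki}x_l,\quad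 [s_{kl},y_i]=\delta_{li}y_k-\delta_{ki}y_l,$$ $$[s_{ij},s_{kl}]=\delta_{kj}s_{il}+\delta_{il}s_{jk}+\delta_{lj}s_{ki}+\delta_{ki}s_{lj};$$ all other brackets between basis elements of different types, and $[x_i,x_j]$, $[y_i,y_j]$, $[x_i,y_j]$ for $i\ne j$, vanish; $z$ is central. For $n=1$, $\mathfrak{so}_1=0$. $U(\cdot)$ denotes the universal enveloping algebra, and $\langle z-\dot z\rangle$ is the two-sided ideal generated by $z-\dot z$. $\mathfrak{D}_n$ is the Weyl algebra of rank $n$: the associative $\mathbb{C}$-algebra generated by $t_1,\dots,t_n,\partial_1,\dots,\partial_n$ with relations $[\partial_i,\partial_j]=[t_i,t_j]=0$, $[\partial_i,t_j]=\delta_{i,j}$. Fix a square root $\sqrt{\dot z}$. In $\mathfrak{D}_n$ put $\tilde x_i=\sqrt{\dot z}\,\partial_i$, $\tilde y_i=\sqrt{\dot z}\,t_i$, $\tilde e=\frac12\sum_{k=1}^n\partial_k^2$, $\tilde f=-\frac12\sum_{k=1}^nt_k^2$, $\tilde h=-\frac12\sum_{k=1}^n(\partial_kt_k+t_k\partial_k)$, $\tilde s_{ij}=t_i\partial_j-t_j\partial_i$. *)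

(* Defs.v *)
From HB Require Import structures.
From mathcomp Require Import all_boot all_order all_algebra ring_quotient.
From mathcomp Require Import boolp classical_sets reals complex.
From mathcomp Require Import finmap monalg ring.

Set Implicit Arguments.
Unset Strict Implicit.
Unset Printing Implicit Defensive.

Import GRing.Theory.
Local Open Scope quotient_scope.
Local Open Scope ring_scope.

(* Unital associative K-algebras, given by a ring A with a central ring
   morphism K -> A.  The algType of MathComp requires 1 != 0, which is not
   known beforehand for an algebra given by generators and relations. *)
HB.mixin Record isAssocAlg (K : fieldType) A of GRing.PzRing A := {
  scal : K -> A;
  scal_zmod_morphism : zmod_morphism scal;
  scal_monoid_morphism : monoid_morphism scal;
  scal_central : forall a u, scal a * u = u * scal a
}.

#[short(type="assocAlgType")]
HB.structure Definition AssocAlg (K : fieldType) :=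
  {A of isAssocAlg K A & GRing.PzRing A}.

Arguments scal {K s} : rename.

HB.instance Definition _ (K : fieldType) (A : assocAlgType K) :=
  GRing.isZmodMorphism.Build K A (@scal K A) (@scal_zmod_morphism K A).
HB.instance Definition _ (K : fieldType) (A : assocAlgType K) :=
  GRing.isMonoidMorphism.Build K A (@scal K A) (@scal_monoid_morphism K A).


HB.mixin Record isTwoSided (R : pzRingType) (I : {pred R}) := {
  bi_idealMl : forall a x, x \in I -> a * x \in I;
  bi_idealMr : forall a x, x \in I -> x * a \in I
}.

#[short(type="biideal")]
HB.structure Definition BiIdeal (R : pzRingType) :=
  {I of GRing.ZmodClosed R I & isTwoSided R I}.


Section QuotientRing.
Variables (R : pzRingType) (I : biideal R).

Definition bquot : Type := @Quotient.quot R I.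
HB.instance Definition _ := GRing.Zmodule.on bquot.

Definition bpi : R -> bquot := \pi_(@Quotient.quot R I).

Lemma bpi_eq x y : (bpi x == bpi y) = (x - y \in I).
Proof. by rewrite Quotient.idealrBE. Qed.

Lemma bpi_surj (q : bquot) : exists x, bpi x = q.
Proof. by exists (repr (q : @Quotient.quot R I)); rewrite /bpi reprK. Qed.

Lemma bpi_is_zmod_morphism : zmod_morphism bpi.
Proof. by move=> x y; rewrite /bpi raddfB. Qed.
HB.instance Definition _ := GRing.isZmodMorphism.Build R bquot bpi
  bpi_is_zmod_morphism.

Definition bquot_one : bquot := bpi 1.
Definition bquot_mul (p q : bquot) : bquot :=
  bpi (repr (p : @Quotient.quot R I) * repr (q : @Quotient.quot R I)).

Lemma bpi_mul x y : bpi (x * y) = bquot_mul (bpi x) (bpi y).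
Proof.
rewrite /bquot_mul; set x' := repr _; set y' := repr _.
have xx' : x - x' \in I by rewrite -bpi_eq /bpi reprK.
have yy' : y - y' \in I by rewrite -bpi_eq /bpi reprK.
apply/eqP; rewrite bpi_eq.
have -> : x * y - x' * y' = (x - x') * y + x' * (y - y').
  by rewrite mulrBl mulrBr addrA subrK.
by apply: rpredD; [exact: bi_idealMr | exact: bi_idealMl].
Qed.

Lemma bquot_mulA : associative bquot_mul.
Proof.
move=> p q r.
have [[x <-] [y <-] [z <-]] := And3 (bpi_surj p) (bpi_surj q) (bpi_surj r).
by rewrite -!bpi_mul mulrA.
Qed.

Lemma bquot_mul1 : left_id bquot_one bquot_mul.
Proof. by move=> p; case: (bpi_surj p) => x <-; rewrite -bpi_mul mul1r. Qed.

Lemma bquot_mulr1 : right_id bquot_one bquot_mul.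
Proof. by move=> p; case: (bpi_surj p) => x <-; rewrite -bpi_mul mulr1. Qed.

Lemma bquot_mulDl : left_distributive bquot_mul +%R.
Proof.
move=> p q r.
have [[x <-] [y <-] [z <-]] := And3 (bpi_surj p) (bpi_surj q) (bpi_surj r).
by rewrite -raddfD -!bpi_mul mulrDl raddfD.
Qed.

Lemma bquot_mulDr : right_distributive bquot_mul +%R.
Proof.
move=> p q r.
have [[x <-] [y <-] [z <-]] := And3 (bpi_surj p) (bpi_surj q) (bpi_surj r).
by rewrite -raddfD -!bpi_mul mulrDr raddfD.
Qed.

HB.instance Definition _ := GRing.Zmodule_isPzRing.Build bquot
  bquot_mulA bquot_mul1 bquot_mulr1 bquot_mulDl bquot_mulDr.

Lemma bpi_is_monoid_morphism : monoid_morphism bpi.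
Proof. by split=> // x y; rewrite bpi_mul. Qed.
HB.instance Definition _ := GRing.isMonoidMorphism.Build R bquot bpi
  bpi_is_monoid_morphism.

End QuotientRing.

Section QuotientAlgebra.
Variables (K : fieldType) (A : assocAlgType K) (I : biideal A).

Definition bquot_scal (a : K) : bquot I := bpi I (scal a).

Lemma bquot_scal_zmod_morphism : zmod_morphism bquot_scal.
Proof. by move=> a b; rewrite /bquot_scal !raddfB. Qed.

Lemma bquot_scal_monoid_morphism : monoid_morphism bquot_scal.
Proof. by split=> [|a b]; rewrite /bquot_scal ?rmorph1 // !rmorphM. Qed.

Lemma bquot_scal_central a (p : bquot I) : bquot_scal a * p = p * bquot_scal a.
Proof.
by case: (bpi_surj p) => x <-; rewrite /bquot_scal -!rmorphM scal_central.
Qed.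

HB.instance Definition _ := isAssocAlg.Build K (bquot I)
  bquot_scal_zmod_morphism bquot_scal_monoid_morphism bquot_scal_central.

End QuotientAlgebra.

Section GeneratedIdeal.
Variables (R : pzRingType) (S : set R).

Inductive in_ideal : R -> Prop :=
| in_ideal_gen x of S x : in_ideal x
| in_ideal0 : in_ideal 0
| in_idealB x y of in_ideal x & in_ideal y : in_ideal (x - y)
| in_idealMl a x of in_ideal x : in_ideal (a * x)
| in_idealMr a x of in_ideal x : in_ideal (x * a).

Definition ideal_gen : {pred R} := fun x => `[< in_ideal x >].

Lemma ideal_genP x : reflect (in_ideal x) (x \in ideal_gen).
Proof. exact: asboolP. Qed.

Lemma ideal_gen_zmod_closed : zmod_closed ideal_gen.
Proof.
split=> [|x y /ideal_genP Ix /ideal_genP Iy]; apply/ideal_genP.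
  exact: in_ideal0.
exact: in_idealB.
Qed.
HB.instance Definition _ := GRing.isZmodClosed.Build R ideal_gen
  ideal_gen_zmod_closed.

Lemma ideal_gen_mull a x : x \in ideal_gen -> a * x \in ideal_gen.
Proof. by move/ideal_genP=> Ix; apply/ideal_genP/in_idealMl. Qed.

Lemma ideal_gen_mulr a x : x \in ideal_gen -> x * a \in ideal_gen.
Proof. by move/ideal_genP=> Ix; apply/ideal_genP/in_idealMr. Qed.

HB.instance Definition _ := isTwoSided.Build R ideal_gen
  ideal_gen_mull ideal_gen_mulr.

End GeneratedIdeal.

(* A / <S>, with projection alg_proj S : A -> A / <S>. *)
Notation alg_quot S := (bquot (ideal_gen S)).
Notation alg_proj S := (bpi (ideal_gen S)).

Section FreeAlgebra.

Definition word (X : choiceType) := seq X.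

Section Word.
Variable X : choiceType.

HB.instance Definition _ := Choice.on (word X).

Let word_unit (x y : word X) : x ++ y = [::] -> x = [::] /\ y = [::].
Proof. by case: x. Qed.

HB.instance Definition _ := Choice_isMonomialDef.Build (word X)
  (@catA X) (@cat0s X) (@cats0 X) word_unit.
End Word.

Variables (K : fieldType) (X : choiceType).

(* The free algebra K<X> is the monoid algebra of the free monoid on X. *)
Definition free_alg : Type := {malg K[word X]}.
HB.instance Definition _ := GRing.NzRing.on free_alg.

Definition free_gen (x : X) : free_alg := mkmalgU ([:: x] : word X) 1.

Definition free_scal (a : K) : free_alg := mkmalgU (mone : word X) a.

Lemma free_scal_zmod_morphism : zmod_morphism free_scal.
Proof. by move=> a b; rewrite /free_scal raddfB. Qed.

Lemma free_scal_monoid_morphism : monoid_morphism free_scal.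
Proof. by split=> [|a b]; rewrite /free_scal ?rmorph1 ?rmorphM. Qed.

Lemma free_scal_central a (u : free_alg) : free_scal a * u = u * free_scal a.
Proof.
rewrite /free_scal [LHS]fgmulUg [RHS]fgmulgU; apply: eq_bigr => k _.
by rewrite mul1m mulm1 mulrC.
Qed.

HB.instance Definition _ := isAssocAlg.Build K free_alg
  free_scal_zmod_morphism free_scal_monoid_morphism free_scal_central.

End FreeAlgebra.

(* The ring Z[M] of the multiplicative monoid of M.  The ring structure of
   {malg _[_]} is not used: it is for monoids without invertible elements
   other than 1. *)
Definition monring (M : pzRingType) : Type := {malg int[M]}.
HB.instance Definition _ (M : pzRingType) := GRing.Zmodule.on (monring M).

HB.lock Definition mr_of (M : pzRingType) (k : M) : monring M := mkmalgU k 1.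

HB.lock Definition mr_lin (M : pzRingType) (V : zmodType) (h : M -> V)
    (g : monring M) : V :=
  \sum_(k <- msupp g) h k *~ mcoeff k g.

HB.lock Definition mr_mul (M : pzRingType) (g1 g2 : monring M) : monring M :=
  mr_lin (fun k1 => mr_lin (fun k2 => mr_of (k1 * k2)) g2) g1.

Section MonoidRing.
Variable M : pzRingType.
Local Notation monring := (monring M).
Implicit Types (g x y z : monring) (k l m : M).

Lemma mr_linE (V : zmodType) (h : M -> V) g :
  mr_lin h g = \sum_(k <- msupp g) h k *~ mcoeff k g.
Proof. by rewrite mr_lin.unlock. Qed.

Lemma mr_linEw (V : zmodType) (h : M -> V) (d : {fset M}) (g : monring) :
  (msupp g `<=` d)%fset -> mr_lin h g = \sum_(k <- d) h k *~ mcoeff k g.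
Proof.
move=> le; rewrite mr_linE (big_fset_incl _ le) //= => k kd /mcoeff_outdom ->.
by rewrite mulr0z.
Qed.

Lemma mr_lin_zmod_morphism (V : zmodType) (h : M -> V) : zmod_morphism (mr_lin h).
Proof.
move=> g1 g2; set d := (msupp g1 `|` msupp g2 `|` msupp (g1 - g2))%fset.
rewrite !(@mr_linEw _ _ d) -?sumrB.
- by apply: eq_bigr => k _; rewrite mcoeffB mulrzBr.
- by apply/fsubsetP => k; rewrite !inE => ->; rewrite orbT.
- by apply/fsubsetP => k; rewrite !inE => ->.
- by apply/fsubsetP => k; rewrite !inE => ->; rewrite orbT.
Qed.

HB.instance Definition _ (V : zmodType) (h : M -> V) :=
  GRing.isZmodMorphism.Build monring V (mr_lin h) (mr_lin_zmod_morphism h).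

Lemma mr_lin_of (V : zmodType) (h : M -> V) (k : M) : mr_lin h (mr_of k) = h k.
Proof. by rewrite mr_of.unlock (mr_linEw h msuppU_le) big_seq_fset1 mcoeffUU. Qed.

Lemma monring_ind (P : monring -> Prop) :
  P 0 -> (forall g1 g2, P g1 -> P g2 -> P (g1 - g2)) ->
  (forall k : M, P (mr_of k)) -> forall g, P g.
Proof.
move=> P0 PB Pk g.
have PN g1 : P g1 -> P (- g1) by move=> ?; rewrite -sub0r; apply: PB.
have PD g1 g2 : P g1 -> P g2 -> P (g1 + g2).
  by move=> ? ?; rewrite -[g2]opprK; apply: PB => //; apply: PN.
rewrite [g]monalgE; elim/big_ind: _ => // k _.
have PMn n : P (mr_of (k : M) *+ n) by elim: n => // n IH; rewrite mulrS; apply: PD.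
have -> : mkmalgU k (mcoeff k g) = mr_of (k : M) *~ mcoeff k g :> monring.
  by rewrite mr_of.unlock -raddfMz intz.
by case: (mcoeff k g) => n; [exact: PMn | apply: PN; exact: PMn].
Qed.

Lemma mr_mul_of (k1 k2 : M) : mr_mul (mr_of k1) (mr_of k2) = mr_of (k1 * k2).
Proof. by rewrite mr_mul.unlock !mr_lin_of. Qed.

Lemma mr_mulBl g1 g2 g : mr_mul (g1 - g2) g = mr_mul g1 g - mr_mul g2 g.
Proof. by rewrite mr_mul.unlock raddfB. Qed.

Lemma mr_mulBr g g1 g2 : mr_mul g (g1 - g2) = mr_mul g g1 - mr_mul g g2.
Proof.
rewrite mr_mul.unlock 3!(mr_linE _ g) -sumrB; apply: eq_bigr => k _.
by rewrite -mulrzBl -mr_lin_zmod_morphism.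
Qed.

Lemma mr_mul0l g : mr_mul 0 g = 0.
Proof. by rewrite mr_mul.unlock raddf0. Qed.

Lemma mr_mul0r g : mr_mul g 0 = 0.
Proof. by rewrite -[X in mr_mul g X](subrr 0) mr_mulBr subrr. Qed.

Lemma mr_mulA : associative (@mr_mul M).
Proof.
move=> x y z; elim/monring_ind: x => [|x1 x2 IH1 IH2|k].
- by rewrite !mr_mul0l.
- by rewrite !mr_mulBl IH1 IH2.
elim/monring_ind: y => [|y1 y2 IH1 IH2|l].
- by rewrite !(mr_mul0l, mr_mul0r).
- by rewrite !(mr_mulBl, mr_mulBr) IH1 IH2.
elim/monring_ind: z => [|z1 z2 IH1 IH2|m].
- by rewrite !mr_mul0r.
- by rewrite !mr_mulBr IH1 IH2.
by rewrite !mr_mul_of mulrA.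
Qed.

Lemma mr_mul1r : left_id (mr_of 1) (@mr_mul M).
Proof.
elim/monring_ind => [|x1 x2 IH1 IH2|k]; first by rewrite mr_mul0r.
  by rewrite mr_mulBr IH1 IH2.
by rewrite mr_mul_of mul1r.
Qed.

Lemma mr_mulr1 : right_id (mr_of 1) (@mr_mul M).
Proof.
elim/monring_ind => [|x1 x2 IH1 IH2|k]; first by rewrite mr_mul0l.
  by rewrite mr_mulBl IH1 IH2.
by rewrite mr_mul_of mulr1.
Qed.

Lemma mr_mulDl : left_distributive (@mr_mul M) +%R.
Proof.
move=> x y z; rewrite -[y in LHS]opprK mr_mulBl; congr (_ + _).
by rewrite -[- y]sub0r mr_mulBl mr_mul0l sub0r opprK.
Qed.

Lemma mr_mulDr : right_distributive (@mr_mul M) +%R.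
Proof.
move=> x y z; rewrite -[z in LHS]opprK mr_mulBr; congr (_ + _).
by rewrite -[- z]sub0r mr_mulBr mr_mul0r sub0r opprK.
Qed.

HB.instance Definition _ := GRing.Zmodule_isPzRing.Build monring
  mr_mulA mr_mul1r mr_mulr1 mr_mulDl mr_mulDr.

Lemma mr_ofM (k l : M) : mr_of (k * l) = mr_of k * mr_of l.
Proof. by rewrite -mr_mul_of. Qed.

End MonoidRing.

Section TensorProduct.
Variables (K : fieldType) (A B : assocAlgType K).

Local Notation F := (monring (A * B)%type).
Local Notation of_pair a b := (mr_of ((a, b) : (A * B)%type)).

(* Subgroup of the free abelian group on A x B whose quotient is the tensor
   product over K. *)
Inductive tensor_null : F -> Prop :=
| tensor_null0 : tensor_null 0
| tensor_nullB g1 g2 of tensor_null g1 & tensor_null g2 :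
    tensor_null (g1 - g2)
| tensor_nullDl a a' b :
    tensor_null (of_pair (a + a') b - of_pair a b - of_pair a' b)
| tensor_nullDr a b b' :
    tensor_null (of_pair a (b + b') - of_pair a b - of_pair a b')
| tensor_nullZ c a b :
    tensor_null (of_pair (scal c * a) b - of_pair a (scal c * b)).

Definition tensor_null_pred : {pred F} := fun g => `[< tensor_null g >].

Lemma tensor_nullP g : reflect (tensor_null g) (g \in tensor_null_pred).
Proof. exact: asboolP. Qed.

Lemma tensor_null_zmod_closed : zmod_closed tensor_null_pred.
Proof.
split=> [|x y /tensor_nullP Ix /tensor_nullP Iy]; apply/tensor_nullP.
  exact: tensor_null0.
exact: tensor_nullB.
Qed.
HB.instance Definition _ := GRing.isZmodClosed.Build F tensor_null_pred
  tensor_null_zmod_closed.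

Lemma tensor_null_mull h g :
  g \in tensor_null_pred -> h * g \in tensor_null_pred.
Proof.
move/tensor_nullP=> Ng; elim/monring_ind: h => [|h1 h2 IH1 IH2|[c d]].
- by rewrite mul0r rpred0.
- by rewrite mulrBl; apply: rpredB.
elim: Ng => [|g1 g2 _ IH1 _ IH2|a a' b|a b b'|k a b].
- by rewrite mulr0 rpred0.
- by rewrite mulrBr; apply: rpredB.
- rewrite !mulrBr -!mr_ofM; apply/tensor_nullP.
  by rewrite -[(c, d) * (a + a', b)]/(c * (a + a'), d * b) mulrDr;
    apply: tensor_nullDl.
- rewrite !mulrBr -!mr_ofM; apply/tensor_nullP.
  by rewrite -[(c, d) * (a, b + b')]/(c * a, d * (b + b')) mulrDr;
    apply: tensor_nullDr.
- rewrite !mulrBr -!mr_ofM; apply/tensor_nullP.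
  rewrite -[(c, d) * (_, b)]/(c * (scal k * a), d * b).
  rewrite -[(c, d) * (a, _)]/(c * a, d * (scal k * b)).
  by rewrite !mulrA -!scal_central -!mulrA; apply: tensor_nullZ.
Qed.

Lemma tensor_null_mulr h g :
  g \in tensor_null_pred -> g * h \in tensor_null_pred.
Proof.
move/tensor_nullP=> Ng; elim/monring_ind: h => [|h1 h2 IH1 IH2|[c d]].
- by rewrite mulr0 rpred0.
- by rewrite mulrBr; apply: rpredB.
elim: Ng => [|g1 g2 _ IH1 _ IH2|a a' b|a b b'|k a b].
- by rewrite mul0r rpred0.
- by rewrite mulrBl; apply: rpredB.
- rewrite !mulrBl -!mr_ofM; apply/tensor_nullP.
  by rewrite -[(a + a', b) * (c, d)]/((a + a') * c, b * d) mulrDl;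
    apply: tensor_nullDl.
- rewrite !mulrBl -!mr_ofM; apply/tensor_nullP.
  by rewrite -[(a, b + b') * (c, d)]/(a * c, (b + b') * d) mulrDl;
    apply: tensor_nullDr.
- rewrite !mulrBl -!mr_ofM; apply/tensor_nullP.
  rewrite -[(_, b) * (c, d)]/(scal k * a * c, b * d).
  rewrite -[(a, _) * (c, d)]/(a * c, scal k * b * d).
  by rewrite -!mulrA; apply: tensor_nullZ.
Qed.

HB.instance Definition _ := isTwoSided.Build F tensor_null_pred
  tensor_null_mull tensor_null_mulr.

Definition tensor : Type := bquot tensor_null_pred.
HB.instance Definition _ := GRing.PzRing.on tensor.

Definition tens (a : A) (b : B) : tensor := bpi tensor_null_pred (of_pair a b).

Lemma tensDl a a' b : tens (a + a') b = tens a b + tens a' b.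
Proof.
rewrite /tens -raddfD; apply/eqP; rewrite bpi_eq opprD addrA.
exact/tensor_nullP/tensor_nullDl.
Qed.

Lemma tensDr a b b' : tens a (b + b') = tens a b + tens a b'.
Proof.
rewrite /tens -raddfD; apply/eqP; rewrite bpi_eq opprD addrA.
exact/tensor_nullP/tensor_nullDr.
Qed.

Lemma tens_scal c a b : tens (scal c * a) b = tens a (scal c * b).
Proof. by apply/eqP; rewrite bpi_eq; exact/tensor_nullP/tensor_nullZ. Qed.

Lemma tensM a b a' b' : tens (a * a') (b * b') = tens a b * tens a' b'.
Proof. by rewrite /tens -rmorphM -mr_ofM. Qed.

Lemma tens11 : tens 1 1 = 1.
Proof. by rewrite /tens -[RHS](rmorph1 (bpi tensor_null_pred)). Qed.

Lemma tensor_ind (P : tensor -> Prop) :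
  P 0 -> (forall u v, P u -> P v -> P (u - v)) ->
  (forall a b, P (tens a b)) -> forall u, P u.
Proof.
move=> P0 PB Pt u; case: (bpi_surj u) => g <-.
elim/monring_ind: g => [|g1 g2 IH1 IH2|[a b]].
- by rewrite raddf0.
- by rewrite raddfB; apply: PB.
- exact: Pt.
Qed.

Definition tensor_scal (c : K) : tensor := tens (scal c) 1.

Lemma tensor_scal_zmod_morphism : zmod_morphism tensor_scal.
Proof.
move=> c d; apply/eqP; rewrite /tensor_scal eq_sym subr_eq -tensDl.
by rewrite -rmorphD subrK.
Qed.

Lemma tensor_scal_monoid_morphism : monoid_morphism tensor_scal.
Proof.
split=> [|c d]; rewrite /tensor_scal ?rmorph1 ?tens11 //.
by rewrite -tensM mulr1 rmorphM.
Qed.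

Lemma tensor_scal_central c (u : tensor) :
  tensor_scal c * u = u * tensor_scal c.
Proof.
elim/tensor_ind: u => [|u v IHu IHv|a b]; first by rewrite mul0r mulr0.
  by rewrite mulrBl mulrBr IHu IHv.
by rewrite -!tensM scal_central mul1r mulr1.
Qed.

HB.instance Definition _ := isAssocAlg.Build K tensor
  tensor_scal_zmod_morphism tensor_scal_monoid_morphism tensor_scal_central.

End TensorProduct.

Arguments tens {K A B}.
Notation "a \ox b" := (tens a b) (at level 40, left associativity) : ring_scope.

HB.mixin Record isLieAlgebra (K : fieldType) L of GRing.Lmodule K L := {
  lie : L -> L -> L;
  lieDZl : forall (a : K) (x y z : L), lie (a *: x + y) z = a *: lie x z + lie y z;
  lieDZr : forall (a : K) (x y z : L), lie z (a *: x + y) = a *: lie z x + lie z y;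
  liexx : forall x : L, lie x x = 0;
  lie_jacobi : forall x y z : L,
    lie x (lie y z) + lie y (lie z x) + lie z (lie x y) = 0
}.

#[short(type="lieAlgType")]
HB.structure Definition LieAlgebra (K : fieldType) :=
  {L of isLieAlgebra K L & GRing.Lmodule K L}.

Section LieTheory.
Variables (K : fieldType) (L : lieAlgType K).
Implicit Types (x y z : L).

Lemma lieDl x y z : lie (x + y) z = lie x z + lie y z.
Proof. by rewrite -[x]scale1r lieDZl !scale1r. Qed.

Lemma lieDr x y z : lie z (x + y) = lie z x + lie z y.
Proof. by rewrite -[x]scale1r lieDZr !scale1r. Qed.

Lemma lie0l z : lie 0 z = 0.
Proof. by apply: (addrI (lie 0 z)); rewrite -lieDl !addr0. Qed.

Lemma lie0r z : lie z 0 = 0.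
Proof. by apply: (addrI (lie z 0)); rewrite -lieDr !addr0. Qed.

Lemma lieNl x z : lie (- x) z = - lie x z.
Proof. by apply: (addrI (lie x z)); rewrite -lieDl !subrr lie0l. Qed.

Lemma lieNr x z : lie z (- x) = - lie z x.
Proof. by apply: (addrI (lie z x)); rewrite -lieDr !subrr lie0r. Qed.

Lemma lieC x y : lie x y = - lie y x.
Proof.
have := liexx (x + y).
by rewrite lieDl !lieDr !liexx add0r addr0 => /eqP; rewrite addr_eq0 => /eqP.
Qed.

End LieTheory.

Section LieDirectSum.
Variables (K : fieldType) (L1 L2 : lieAlgType K).

Definition dsum_lie (x y : L1 * L2) : L1 * L2 := (lie x.1 y.1, lie x.2 y.2).

Lemma dsum_lieDZl a x y z :
  dsum_lie (a *: x + y) z = a *: dsum_lie x z + dsum_lie y z.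
Proof. by rewrite /dsum_lie /= !lieDZl. Qed.

Lemma dsum_lieDZr a x y z :
  dsum_lie z (a *: x + y) = a *: dsum_lie z x + dsum_lie z y.
Proof. by rewrite /dsum_lie /= !lieDZr. Qed.

Lemma dsum_liexx x : dsum_lie x x = 0.
Proof. by rewrite /dsum_lie !liexx. Qed.

Lemma dsum_jacobi x y z :
  dsum_lie x (dsum_lie y z) + dsum_lie y (dsum_lie z x)
  + dsum_lie z (dsum_lie x y) = 0.
Proof. by apply: (@pair_equal_spec _ _ _ _ _ _).2; split; exact: lie_jacobi. Qed.

HB.instance Definition _ := isLieAlgebra.Build K (L1 * L2)%type
  dsum_lieDZl dsum_lieDZr dsum_liexx dsum_jacobi.

Definition dsum_inl (x : L1) : (L1 * L2)%type := (x, 0).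
Definition dsum_inr (y : L2) : (L1 * L2)%type := (0, y).

End LieDirectSum.

Arguments dsum_inl {K L1 L2}.
Arguments dsum_inr {K L1 L2}.


(* Representations of g on h by derivations. *)
Record lie_action (K : fieldType) (g h : lieAlgType K) := LieAction {
  lact :> g -> h -> h;
  lactDZl : forall a x y u, lact (a *: x + y) u = a *: lact x u + lact y u;
  lactDZr : forall a x u v, lact x (a *: u + v) = a *: lact x u + lact x v;
  lact_lie : forall x y u,
    lact (lie x y) u = lact x (lact y u) - lact y (lact x u);
  lact_der : forall x u v,
    lact x (lie u v) = lie (lact x u) v + lie u (lact x v)
}.

Section LieSemidirect.
Variables (K : fieldType) (g h : lieAlgType K) (rho : lie_action g h).

Definition semidirect of lie_action g h : Type := (g * h)%type.
HB.instance Definition _ := GRing.Lmodule.on (semidirect rho).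

Implicit Types x y z : semidirect rho.

Definition sd_lie x y : semidirect rho :=
  (lie x.1 y.1, lie x.2 y.2 + rho x.1 y.2 - rho y.1 x.2).

Lemma sd_lieDZl a x y z : sd_lie (a *: x + y) z = a *: sd_lie x z + sd_lie y z.
Proof.
rewrite /sd_lie /= !lieDZl lactDZl lactDZr; congr (_, _) => /=.
rewrite !scalerDr scalerN !opprD !addrA.
by rewrite [LHS](ACl (1 * 3 * 5 * 2 * 4 * 6)).
Qed.

Lemma sd_lieDZr a x y z : sd_lie z (a *: x + y) = a *: sd_lie z x + sd_lie z y.
Proof.
rewrite /sd_lie /= !lieDZr lactDZl lactDZr; congr (_, _) => /=.
rewrite !scalerDr scalerN !opprD !addrA.
by rewrite [LHS](ACl (1 * 3 * 5 * 2 * 4 * 6)).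
Qed.

Lemma sd_liexx x : sd_lie x x = 0.
Proof. by rewrite /sd_lie !liexx add0r subrr. Qed.

Lemma lactD (x : g) (u v : h) : rho x (u + v) = rho x u + rho x v.
Proof. by rewrite -[u]scale1r lactDZr !scale1r. Qed.

Lemma lactN (x : g) (u : h) : rho x (- u) = - rho x u.
Proof.
have rho0 : rho x 0 = 0 by apply: (addrI (rho x 0)); rewrite -lactD !addr0.
by apply: (addrI (rho x u)); rewrite -lactD !subrr.
Qed.

Lemma sd_jacobi x y z :
  sd_lie x (sd_lie y z) + sd_lie y (sd_lie z x) + sd_lie z (sd_lie x y) = 0.
Proof.
case: x y z => [x u] [y v] [z w]; rewrite /sd_lie /=.
apply: (@pair_equal_spec _ _ _ _ _ _).2; split; first exact: lie_jacobi.
rewrite /= !(lieDr, lieNr, lactD, lactN, lact_der, lact_lie).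
rewrite [lie (rho x v) w]lieC [lie (rho y w) u]lieC [lie (rho z u) v]lieC.
rewrite !opprD !opprK !addrA [LHS](ACl (1 * 10 * 19 * 2 * 13 * 23 * 3 * 20 * 4
  * 5 * 12 * 6 * 26 * 18 * 7 * 15 * 8 * 9 * 25 * 11 * 22 * 14 * 21 * 27 * 16
  * 24 * 17)).
by rewrite /= lie_jacobi add0r !addrK subrr.
Qed.

HB.instance Definition _ := isLieAlgebra.Build K (semidirect rho)
  sd_lieDZl sd_lieDZr sd_liexx sd_jacobi.

End LieSemidirect.

Section Enveloping.
Variables (K : fieldType) (L : lieAlgType K).

Local Notation F := (free_alg K L).
Local Notation "[ 'g' x ]" := (free_gen K (x : L)) : ring_scope.

(* The first family of relations presents the tensor algebra T(L) as a
   quotient of the free algebra on the set L. *)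
Inductive env_rel : F -> Prop :=
| env_rel_linear a x y :
    env_rel ([g a *: x + y] - (scal a * [g x] + [g y]))
| env_rel_lie x y :
    env_rel ([g x] * [g y] - [g y] * [g x] - [g lie x y]).

Definition env : Type := alg_quot (env_rel : set F).
HB.instance Definition _ := AssocAlg.on env.

Definition env_inj (x : L) : env := alg_proj (env_rel : set F) [g x].

End Enveloping.

Section WeylAlgebra.
Variables (K : fieldType) (n : nat).

Local Notation F := (free_alg K ('I_n + 'I_n)%type).
Local Notation t i := (free_gen K (inl i : 'I_n + 'I_n)%type).
Local Notation d i := (free_gen K (inr i : 'I_n + 'I_n)%type).

Inductive weyl_rel : F -> Prop :=
| weyl_rel_dd i j : weyl_rel (d i * d j - d j * d i)
| weyl_rel_tt i j : weyl_rel (t i * t j - t j * t i)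
| weyl_rel_dt i j : weyl_rel (d i * t j - t j * d i - (i == j)%:R).

Definition weyl : Type := alg_quot (weyl_rel : set F).
HB.instance Definition _ := AssocAlg.on weyl.

Definition weyl_t (i : 'I_n) : weyl := alg_proj (weyl_rel : set F) (t i).
Definition weyl_d (i : 'I_n) : weyl := alg_proj (weyl_rel : set F) (d i).

Definition weyl_x (r : K) (i : 'I_n) : weyl := scal r * weyl_d i.
Definition weyl_y (r : K) (i : 'I_n) : weyl := scal r * weyl_t i.
Definition weyl_e : weyl := scal 2^-1 * \sum_k weyl_d k ^+ 2.
Definition weyl_f : weyl := - (scal 2^-1 * \sum_k weyl_t k ^+ 2).
Definition weyl_h : weyl :=
  - (scal 2^-1 * \sum_k (weyl_d k * weyl_t k + weyl_t k * weyl_d k)).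
Definition weyl_s (i j : 'I_n) : weyl :=
  weyl_t i * weyl_d j - weyl_t j * weyl_d i.

End WeylAlgebra.

Arguments weyl_t {K n}.
Arguments weyl_d {K n}.
Arguments weyl_x {K n}.
Arguments weyl_y {K n}.
Arguments weyl_e {K n}.
Arguments weyl_f {K n}.
Arguments weyl_h {K n}.
Arguments weyl_s {K n}.

Section Schrodinger.
Variable K : fieldType.

Section MatrixCommutator.
Variable m : nat.
Implicit Types A B C : 'M[K]_m.

Definition mxlie A B := A *m B - B *m A.

Lemma mxlieDZl a A B C : mxlie (a *: A + B) C = a *: mxlie A C + mxlie B C.
Proof.
rewrite /mxlie mulmxDl mulmxDr -scalemxAl -scalemxAr scalerBr opprD.
by rewrite addrACA.
Qed.

Lemma mxlieDZr a A B C : mxlie C (a *: A + B) = a *: mxlie C A + mxlie C B.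
Proof.
rewrite /mxlie mulmxDl mulmxDr -scalemxAl -scalemxAr scalerBr opprD.
by rewrite addrACA.
Qed.

Lemma mxliexx A : mxlie A A = 0. Proof. exact: subrr. Qed.

Lemma mxlie_jacobi A B C :
  mxlie A (mxlie B C) + mxlie B (mxlie C A) + mxlie C (mxlie A B) = 0.
Proof.
rewrite /mxlie !mulmxBr !mulmxBl !mulmxA.
move: (A *m B *m C) (A *m C *m B) (B *m A *m C) (B *m C *m A) (C *m A *m B)
  (C *m B *m A) => P1 P2 P3 P4 P5 P6.
by apply/matrixP => i j; rewrite !mxE; ring.
Qed.

Lemma mxtrace_lie A B : \tr (mxlie A B) = 0.
Proof. by rewrite /mxlie raddfB /= mxtrace_mulC subrr. Qed.

Lemma skew_lie A B : A^T = - A -> B^T = - B -> (mxlie A B)^T = - mxlie A B.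
Proof.
move=> hA hB; rewrite /mxlie raddfB /= !trmx_mul hA hB.
by rewrite !mulmxN !mulNmx !opprK opprB.
Qed.
End MatrixCommutator.

Definition sl2_pred : {pred 'M[K]_2} := fun A => \tr A == 0.

Fact sl2_submod_closed : submod_closed sl2_pred.
Proof.
split=> [|a A B /eqP hA /eqP hB]; first by rewrite unfold_in /= mxtrace0.
by rewrite unfold_in /= mxtraceD mxtraceZ hA hB mulr0 addr0.
Qed.
HB.instance Definition _ := GRing.isSubmodClosed.Build K 'M[K]_2 sl2_pred
  sl2_submod_closed.

Record sl2 := Sl2 { sl2_mx :> 'M[K]_2; _ : sl2_mx \in sl2_pred }.
HB.instance Definition _ := [isSub for sl2_mx].
HB.instance Definition _ := [Choice of sl2 by <:].
HB.instance Definition _ := [SubChoice_isSubLmodule of sl2 by <:].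

Fact sl2_lie_subproof (A B : sl2) : mxlie A B \in sl2_pred.
Proof. by rewrite unfold_in /= mxtrace_lie. Qed.
Definition sl2_lie (A B : sl2) : sl2 := Sl2 (sl2_lie_subproof A B).

Fact sl2_lieDZl a x y z : sl2_lie (a *: x + y) z = a *: sl2_lie x z + sl2_lie y z.
Proof. by apply: val_inj; rewrite /= mxlieDZl. Qed.
Fact sl2_lieDZr a x y z : sl2_lie z (a *: x + y) = a *: sl2_lie z x + sl2_lie z y.
Proof. by apply: val_inj; rewrite /= mxlieDZr. Qed.
Fact sl2_liexx x : sl2_lie x x = 0.
Proof. by apply: val_inj; rewrite /= mxliexx. Qed.
Fact sl2_jacobi x y z :
  sl2_lie x (sl2_lie y z) + sl2_lie y (sl2_lie z x) + sl2_lie z (sl2_lie x y) = 0.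
Proof. by apply: val_inj; rewrite /= mxlie_jacobi. Qed.
HB.instance Definition _ := isLieAlgebra.Build K sl2
  sl2_lieDZl sl2_lieDZr sl2_liexx sl2_jacobi.

Fact sl2_e_subproof : delta_mx 0 1 \in sl2_pred.
Proof. by rewrite unfold_in /= /mxtrace !big_ord_recl big_ord0 !mxE /= !addr0. Qed.
Fact sl2_f_subproof : delta_mx 1 0 \in sl2_pred.
Proof. by rewrite unfold_in /= /mxtrace !big_ord_recl big_ord0 !mxE /= !addr0. Qed.
Fact sl2_h_subproof : delta_mx 0 0 - delta_mx 1 1 \in sl2_pred.
Proof.
by rewrite unfold_in /= /mxtrace !big_ord_recl big_ord0 !mxE /= subr0 sub0r
  addr0 subrr.
Qed.

Definition sl2_e : sl2 := Sl2 sl2_e_subproof.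
Definition sl2_f : sl2 := Sl2 sl2_f_subproof.
Definition sl2_h : sl2 := Sl2 sl2_h_subproof.

Variable n : nat.

Definition so_pred : {pred 'M[K]_n} := fun A => A^T == - A.

Fact so_submod_closed : submod_closed so_pred.
Proof.
split=> [|a A B /eqP hA /eqP hB]; first by rewrite unfold_in /= trmx0 oppr0.
by rewrite unfold_in /= raddfD /= linearZ /= hA hB scalerN opprD.
Qed.
HB.instance Definition _ := GRing.isSubmodClosed.Build K 'M[K]_n so_pred
  so_submod_closed.

Record so := So { so_mx :> 'M[K]_n; _ : so_mx \in so_pred }.
HB.instance Definition _ := [isSub for so_mx].
HB.instance Definition _ := [Choice of so by <:].
HB.instance Definition _ := [SubChoice_isSubLmodule of so by <:].

Fact so_lie_subproof (A B : so) : mxlie A B \in so_pred.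
Proof.
case: A B => [A hA] [B hB]; rewrite unfold_in /=; apply/eqP.
by apply: skew_lie; apply/eqP.
Qed.
Definition so_lie (A B : so) : so := So (so_lie_subproof A B).

Fact so_lieDZl a x y z : so_lie (a *: x + y) z = a *: so_lie x z + so_lie y z.
Proof. by apply: val_inj; rewrite /= mxlieDZl. Qed.
Fact so_lieDZr a x y z : so_lie z (a *: x + y) = a *: so_lie z x + so_lie z y.
Proof. by apply: val_inj; rewrite /= mxlieDZr. Qed.
Fact so_liexx x : so_lie x x = 0.
Proof. by apply: val_inj; rewrite /= mxliexx. Qed.
Fact so_jacobi x y z :
  so_lie x (so_lie y z) + so_lie y (so_lie z x) + so_lie z (so_lie x y) = 0.
Proof. by apply: val_inj; rewrite /= mxlie_jacobi. Qed.
HB.instance Definition _ := isLieAlgebra.Build K so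
  so_lieDZl so_lieDZr so_liexx so_jacobi.

Fact so_s_subproof i j : delta_mx i j - delta_mx j i \in so_pred.
Proof. by rewrite unfold_in /= raddfB /= !trmx_delta opprB. Qed.
Definition so_s (i j : 'I_n) : so := So (so_s_subproof i j).

(* h_n: columns 0 and 1 of the matrix are the coordinates on x_1, ..., x_n and
   y_1, ..., y_n; the scalar is the coordinate on z. *)
Definition heis : Type := ('M[K]_(n, 2) * K^o)%type.
HB.instance Definition _ := GRing.Lmodule.on heis.

Definition heis_form (v w : 'M[K]_(n, 2)) : K :=
  \sum_i (v i 0 * w i 1 - v i 1 * w i 0).
Definition heis_lie (u v : heis) : heis := (0, heis_form u.1 v.1).

Fact heis_formDZl a v1 v2 w :
  heis_form (a *: v1 + v2) w = a * heis_form v1 w + heis_form v2 w.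
Proof.
rewrite /heis_form mulr_sumr -big_split /=; apply: eq_bigr => i _.
by rewrite !mxE; ring.
Qed.

Fact heis_formC v w : heis_form v w = - heis_form w v.
Proof. by rewrite /heis_form -sumrN; apply: eq_bigr => i _; ring. Qed.

Fact heis_lieDZl a x y z :
  heis_lie (a *: x + y) z = a *: heis_lie x z + heis_lie y z.
Proof.
apply: (@pair_equal_spec _ _ _ _ _ _).2; split=> /=.
  by rewrite scaler0 addr0.
exact: heis_formDZl.
Qed.
Fact heis_lieDZr a x y z :
  heis_lie z (a *: x + y) = a *: heis_lie z x + heis_lie z y.
Proof.
apply: (@pair_equal_spec _ _ _ _ _ _).2; split=> /=.
  by rewrite scaler0 addr0.
by rewrite heis_formC heis_formDZl opprD -mulrN -!heis_formC.
Qed.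
Fact heis_liexx x : heis_lie x x = 0.
Proof.
congr (_, _); rewrite /heis_form big1 // => i _.
by rewrite mulrC subrr.
Qed.
Fact heis_lie_lie x y z : heis_lie x (heis_lie y z) = 0.
Proof.
congr (_, _); rewrite /heis_form big1 // => i _.
by rewrite !mxE !mulr0 subrr.
Qed.
Fact heis_jacobi x y z :
  heis_lie x (heis_lie y z) + heis_lie y (heis_lie z x)
  + heis_lie z (heis_lie x y) = 0.
Proof. by rewrite !heis_lie_lie !addr0. Qed.
HB.instance Definition _ := isLieAlgebra.Build K heis
  heis_lieDZl heis_lieDZr heis_liexx heis_jacobi.

Definition heis_x (i : 'I_n) : heis := (delta_mx i 0, 0).
Definition heis_y (i : 'I_n) : heis := (delta_mx i 1, 0).
Definition heis_z : heis := (0, 1).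

(* sl_2 acts on the span K^2 of x_k, y_k for each k, and so_n on the span K^n
   of the x_k and on that of the y_k; both kill z. *)
Definition schr_act_fun (a : (sl2 * so)%type) (u : heis) : heis :=
  (a.2 *m u.1 + u.1 *m a.1^T, 0).

Fact schr_act_linl a x y u :
  schr_act_fun (a *: x + y) u = a *: schr_act_fun x u + schr_act_fun y u.
Proof.
apply: (@pair_equal_spec _ _ _ _ _ _).2; split=> /=; last first.
  by rewrite scaler0 addr0.
rewrite mulmxDl -scalemxAl raddfD /= linearZ /= mulmxDr -scalemxAr.
by rewrite scalerDr addrACA.
Qed.

Fact schr_act_linr a x u v :
  schr_act_fun x (a *: u + v) = a *: schr_act_fun x u + schr_act_fun x v.
Proof.
apply: (@pair_equal_spec _ _ _ _ _ _).2; split=> /=; last first.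
  by rewrite scaler0 addr0.
rewrite mulmxDl -scalemxAl mulmxDr -scalemxAr.
by rewrite scalerDr addrACA.
Qed.

Fact schr_act_lie x y u :
  schr_act_fun (lie x y) u =
  schr_act_fun x (schr_act_fun y u) - schr_act_fun y (schr_act_fun x u).
Proof.
apply: (@pair_equal_spec _ _ _ _ _ _).2; split=> /=; last first.
  by rewrite subrr.
rewrite /mxlie raddfB /= !trmx_mul !(mulmxBl, mulmxBr, mulmxDl, mulmxDr) !mulmxA.
rewrite !mulNmx.
move: (x.2 *m _ *m u.1) (y.2 *m _ *m u.1) (x.2 *m u.1 *m _) (y.2 *m u.1 *m _)
  (u.1 *m _ *m y.1^T) (u.1 *m _ *m x.1^T) => P1 P2 P3 P4 P5 P6.
by apply/matrixP => i j; rewrite !mxE; ring.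
Qed.

Fact heis_formE (v w : 'M[K]_(n, 2)) :
  heis_form v w = (v^T *m w) 0 1 - (v^T *m w) 1 0.
Proof. by rewrite !mxE -sumrB; apply: eq_bigr => i _; rewrite !mxE. Qed.

Fact schr_act_der x u v :
  schr_act_fun x (lie u v) =
  lie (schr_act_fun x u) v + lie u (schr_act_fun x v).
Proof.
apply: (@pair_equal_spec _ _ _ _ _ _).2; split=> /=.
  by rewrite mulmx0 mul0mx !addr0.
case: x => [[A /eqP trA] [S /eqP skS]] /=; rewrite !heis_formE.
rewrite raddfD /= !trmx_mul trmxK skS mulmxDl mulmxDr mulmxN mulNmx !mulmxA.
rewrite -[A *m _ *m _]mulmxA.
move: (u.1^T *m v.1) (u.1^T *m S *m v.1) => P Q.
have lift01 : lift ord0 (ord0 : 'I_1) = 1 :> 'I_2 by apply: val_inj.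
have A11 : A 1 1 = - A 0 0.
  apply/eqP; rewrite -addr_eq0 addrC; apply/eqP.
  by rewrite -[RHS]trA /mxtrace !big_ord_recl big_ord0 addr0 lift01.
rewrite !mxE !big_ord_recl !big_ord0 !mxE.
by rewrite lift01 A11 -[ord0]/(0 : 'I_2); ring.
Qed.

Definition schr_act : lie_action (sl2 * so)%type heis :=
  LieAction schr_act_linl schr_act_linr schr_act_lie schr_act_der.

Definition schr : Type := semidirect schr_act.
HB.instance Definition _ := LieAlgebra.on schr.

Definition schr_e : schr := ((sl2_e, 0), 0).
Definition schr_f : schr := ((sl2_f, 0), 0).
Definition schr_h : schr := ((sl2_h, 0), 0).
Definition schr_s (i j : 'I_n) : schr := ((0, so_s i j), 0).
Definition schr_x (i : 'I_n) : schr := (0, heis_x i).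
Definition schr_y (i : 'I_n) : schr := (0, heis_y i).
Definition schr_z : schr := (0, heis_z).

End Schrodinger.

Arguments schr_e {K n}.
Arguments schr_f {K n}.
Arguments schr_h {K n}.
Arguments schr_s {K n}.
Arguments schr_x {K n}.
Arguments schr_y {K n}.
Arguments schr_z {K n}.
Arguments sl2_e {K}.
Arguments sl2_f {K}.
Arguments sl2_h {K}.
Arguments so_s {K n}.

Section SchrodingerBrackets.
Variables (K : fieldType) (n : nat).
Implicit Types (i j k l : 'I_n).
Local Notation s_n := (schr K n).

Let pairE (A B : Type) (p q : A * B) : p.1 = q.1 -> p.2 = q.2 -> p = q.
Proof. by case: p q => [a b] [c d] /= -> ->. Qed.

Lemma heis_form0l (w : 'M[K]_(n, 2)) : heis_form 0 w = 0.
Proof. by rewrite /heis_form big1 // => i _; rewrite !mxE !mul0r subrr. Qed.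

Lemma heis_form0r (w : 'M[K]_(n, 2)) : heis_form w 0 = 0.
Proof. by rewrite heis_formC heis_form0l oppr0. Qed.

Let I2 : (1 == 0 :> 'I_2) = false. Proof. by []. Qed.
Let I2' : (0 == 1 :> 'I_2) = false. Proof. by []. Qed.

Lemma heis_form_delta i j (a b : 'I_2) :
  heis_form (delta_mx i a) (delta_mx j b)
  = (i == j)%:R * (((a == 0) && (b == 1))%:R - ((a == 1) && (b == 0))%:R) :> K.
Proof.
rewrite heis_formE trmx_delta mul_delta_mx_cond.
by case: (i == j); rewrite !mxE ?subrr ?mul0r ?mul1r // ![0 == _]eq_sym ![1 == _]eq_sym.
Qed.

Ltac schr_unfold :=
  apply: pairE; [apply: pairE; apply: val_inj | apply: pairE];
  rewrite /= /sl2_lie /so_lie /mxlie /= ?(lie0l, lie0r) /=;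
  rewrite ?(raddfB, linear0) /= ?trmx_delta.
Ltac schr_simp :=
  rewrite ?(mulmx0, mul0mx, addr0, add0r, subr0, sub0r, oppr0, scaler0,
    heis_form0l, heis_form0r) //.
Ltac schr_mx :=
  rewrite ?(mulmxBl, mulmxBr) ?mul_delta_mx_cond ?I2 ?I2' ?eqxx
    ?(mulr0n, mulr1n); schr_simp.

Lemma schr_he : lie schr_h schr_e = 2 *: schr_e :> s_n.
Proof. by schr_unfold; schr_mx; rewrite opprK scaler_nat mulr2n. Qed.
Lemma schr_hf : lie schr_h schr_f = - 2 *: schr_f :> s_n.
Proof. by schr_unfold; schr_mx; rewrite scaleNr scaler_nat mulr2n opprD. Qed.
Lemma schr_ef : lie schr_e schr_f = schr_h :> s_n.
Proof. schr_unfold; schr_mx. Qed.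
Lemma schr_xy i j : lie (schr_x i) (schr_y j) = (i == j)%:R *: schr_z :> s_n.
Proof. by schr_unfold; schr_mx; rewrite heis_form_delta !eqxx I2 andbF subr0 mulr1 [RHS]mulr1. Qed.
Lemma schr_hx i : lie schr_h (schr_x i) = schr_x i :> s_n.
Proof. schr_unfold; schr_mx. Qed.
Lemma schr_hy i : lie schr_h (schr_y i) = - schr_y i :> s_n.
Proof. schr_unfold; schr_mx. Qed.
Lemma schr_ey i : lie schr_e (schr_y i) = schr_x i :> s_n.
Proof. schr_unfold; schr_mx. Qed.
Lemma schr_fx i : lie schr_f (schr_x i) = schr_y i :> s_n.
Proof. schr_unfold; schr_mx. Qed.
Lemma schr_ex i : lie schr_e (schr_x i) = 0 :> s_n.
Proof. schr_unfold; schr_mx. Qed.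
Lemma schr_fy i : lie schr_f (schr_y i) = 0 :> s_n.
Proof. schr_unfold; schr_mx. Qed.
Lemma schr_xx i j : lie (schr_x i) (schr_x j) = 0 :> s_n.
Proof. by schr_unfold; schr_mx; rewrite heis_form_delta ?I2 ?I2' ?andbF subrr mulr0. Qed.
Lemma schr_yy i j : lie (schr_y i) (schr_y j) = 0 :> s_n.
Proof. by schr_unfold; schr_mx; rewrite heis_form_delta ?I2 ?I2' ?andbF subrr mulr0. Qed.
Lemma schr_sx k l i :
  lie (schr_s k l) (schr_x i)
  = (l == i)%:R *: schr_x k - (k == i)%:R *: schr_x l :> s_n.
Proof. by schr_unfold; schr_mx; rewrite !scaler_nat. Qed.
Lemma schr_sy k l i :
  lie (schr_s k l) (schr_y i)
  = (l == i)%:R *: schr_y k - (k == i)%:R *: schr_y l :> s_n.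
Proof. by schr_unfold; schr_mx; rewrite !scaler_nat. Qed.
Lemma schr_ss i j k l :
  lie (schr_s i j) (schr_s k l)
  = (k == j)%:R *: schr_s i l + (i == l)%:R *: schr_s j k
    + (l == j)%:R *: schr_s k i + (k == i)%:R *: schr_s l j :> s_n.
Proof. 
schr_unfold; schr_mx; rewrite !scaler_nat (eq_sym k j) (eq_sym k i) (eq_sym l i).
rewrite (eq_sym l j).
move: (j == k) (i == k) (j == l) (i == l) => b1 b2 b3 b4.
move: (delta_mx i l) (delta_mx l i) (delta_mx j l) (delta_mx l j).
move: (delta_mx i k) (delta_mx k i) (delta_mx j k) (delta_mx k j).
move=> A1 A2 A3 A4 A5 A6 A7 A8; apply/matrixP => p q; rewrite !mxE.
case: b1; case: b2; case: b3; case: b4; rewrite ?mulr0n ?mulr1n ?mxE; ring. Qed.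
Lemma schr_lez (u : s_n) : lie u schr_z = 0 :> s_n.
Proof. schr_unfold; schr_mx. Qed.
Lemma schr_gs (a : sl2 K) i j : lie ((a, 0), 0) (schr_s i j) = 0 :> s_n.
Proof. schr_unfold; schr_mx. Qed.
Lemma schr_sC i j : schr_s j i = - schr_s i j :> s_n.
Proof. by schr_unfold; schr_mx; rewrite opprK addrC. Qed.

Lemma schr_decomp (u : s_n) : (2 : K) != 0 ->
  u = u.1.1 0 1 *: schr_e + u.1.1 1 0 *: schr_f + u.1.1 0 0 *: schr_h
    + \sum_(i < n) \sum_(j < n | (i < j)%N) u.1.2 i j *: schr_s i j
    + \sum_i u.2.1 i 0 *: schr_x i + \sum_i u.2.1 i 1 *: schr_y i
    + (u.2.2 : K) *: schr_z.
Proof.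
move=> nz2.
have E1 (I : finType) (P : pred I) (F : I -> s_n) :
  (\sum_(i | P i) F i : s_n).1.1 = \sum_(i | P i) ((F i).1.1 : 'M[K]_2) :> 'M[K]_2.
  apply: (big_ind2 (fun (v : s_n) (w : 'M[K]_2) => val v.1.1 = w)) => // a ? b ? <- <-.
  by [].
have E2 (I : finType) (P : pred I) (F : I -> s_n) :
  (\sum_(i | P i) F i : s_n).1.2 = \sum_(i | P i) ((F i).1.2 : 'M[K]_n) :> 'M[K]_n.
  apply: (big_ind2 (fun (v : s_n) (w : 'M[K]_n) => val v.1.2 = w)) => // a ? b ? <- <-.
  by [].
have E3 (I : finType) (P : pred I) (F : I -> s_n) :
  (\sum_(i | P i) F i : s_n).2.1 = \sum_(i | P i) ((F i).2.1 : 'M[K]_(n, 2)) :> 'M[K]_(n, 2).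
  apply: (big_ind2 (fun (v : s_n) (w : 'M[K]_(n, 2)) => v.2.1 = w)) => // a ? b ? <- <-.
  by [].
have E4 (I : finType) (P : pred I) (F : I -> s_n) :
  (\sum_(i | P i) F i : s_n).2.2 = \sum_(i | P i) ((F i).2.2 : K) :> K.
  apply: (big_ind2 (fun (v : s_n) (w : K) => v.2.2 = w)) => // a ? b ? <- <-.
  by [].
case: u => [[A S] [v c]]; apply: pairE; apply: pairE; [apply: val_inj | apply: val_inj | |].
- case: A => [A /eqP trA] /=; rewrite !E1 !big1; last first.
  + by move=> i _ /=; rewrite ?E1 ?scaler0 // big1 // => j _; rewrite /= scaler0.
  + by move=> i _ /=; rewrite ?E1 ?scaler0 // big1 // => j _; rewrite /= scaler0.
  + by move=> i _ /=; rewrite ?E1 ?scaler0 // big1 // => j _; rewrite /= scaler0.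
  have lift01 : lift ord0 (ord0 : 'I_1) = 1 :> 'I_2 by apply: val_inj.
  have A11 : A 1 1 = - A 0 0.
    apply/eqP; rewrite -addr_eq0 addrC; apply/eqP.
    by rewrite -[RHS]trA /mxtrace !big_ord_recl big_ord0 addr0 lift01.
  rewrite scaler0 !addr0; apply/matrixP => p q; rewrite !mxE.
  have I2P (r : 'I_2) : r = 0 \/ r = 1.
    by case: r => [[|[|r]] lt_r] //; [left | right]; apply: val_inj.
  by case: (I2P p) (I2P q) => -> [] -> /=;
    rewrite ?A11 ?(mulr0, mulr1, subr0, sub0r, addr0, add0r, oppr0, mulrN1).
- case: S => [S /eqP skS] /=; rewrite !E2.
  rewrite [X in _ + X + _ + _]big1; last by move=> i _; rewrite /= scaler0.
  rewrite [X in _ + X + _]big1; last by move=> i _; rewrite /= scaler0.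
  rewrite !scaler0 !addr0 add0r; apply/matrixP => p q.
  rewrite (eq_bigr (fun i => \sum_(j < n | (i < j)%N)
    S i j *: (delta_mx i j - delta_mx j i))); last by move=> i _; rewrite E2.
  have Sqp r s : S s r = - S r s.
    by have := congr1 (fun M : 'M[K]_n => M r s) skS; rewrite !mxE.
  have key (r s : 'I_n) : \sum_(i < n) \sum_(j < n | (i < j)%N)
      S i j * ((r == i) && (s == j))%:R = (r < s)%N%:R * S r s.
    rewrite (bigD1 r) //= [X in _ + X]big1 ?addr0; last first.
      move=> i /negPf ir; rewrite big1 // => j _.
      by rewrite [r == i]eq_sym ir mulr0.
    rewrite big_mkcond (bigD1 s) //= [X in _ + X]big1 ?addr0; last first.
      by move=> j /negPf js; rewrite [s == j]eq_sym js andbF mulr0 if_same.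
    by rewrite !eqxx; case: ifP; rewrite ?mulr1 ?mul1r ?mul0r.
  have -> : (\sum_(i < n) \sum_(j < n | (i < j)%N)
      S i j *: (delta_mx i j - delta_mx j i)) p q
    = (p < q)%N%:R * S p q - (q < p)%N%:R * S q p.
    rewrite -!key summxE -sumrB; apply: eq_bigr => i _.
    rewrite summxE -sumrB; apply: eq_bigr => j _.
    by rewrite !mxE mulrBr [in X in _ - X]andbC.
  rewrite (Sqp p q); case: (ltngtP p q) => [_|_|/val_inj ->] /=.
  + by rewrite mul1r mul0r subr0.
  + by rewrite mul0r mul1r opprK add0r.
  + rewrite !mul0r subrr; apply/eqP.
    have : S q q + S q q = 0 by rewrite {1}Sqp addNr.
    by move/eqP; rewrite -mulr2n -mulr_natl mulf_eq0 (negPf nz2).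
- rewrite /= !E3 /= [X in _ + X + _ + _ + _]big1; last first.
    by move=> i _; rewrite E3 big1 // => j _; rewrite /= scaler0.
  rewrite !scaler0 !add0r !addr0; apply/matrixP => p q.
  rewrite !mxE !summxE (bigD1 p) //= big1 ?addr0; last first.
    by move=> i /negPf ip; rewrite !mxE [p == i]eq_sym ip mulr0.
  rewrite (bigD1 p) //= big1 ?addr0; last first.
    by move=> i /negPf ip; rewrite !mxE [p == i]eq_sym ip mulr0.
  rewrite !mxE eqxx; case: q => [[|[|q]] lt_q] //.
    by rewrite mulr1 mulr0 addr0; congr (v _ _); apply: val_inj.
  by rewrite mulr1 mulr0 add0r; congr (v _ _); apply: val_inj.
- rewrite /= !E4 /= [X in _ + X + _ + _ + _]big1; last first.
    by move=> i _; rewrite E4 big1 // => j _; rewrite /= scaler0.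
  rewrite [X in _ + X + _ + _]big1; last by move=> i _; rewrite scaler0.
  rewrite [X in _ + X + _]big1; last by move=> i _; rewrite scaler0.
  by rewrite !scaler0 !add0r [RHS]mulr1.
Qed.

End SchrodingerBrackets.

Section SchrodingerQuotient.
Variables (K : fieldType) (n : nat) (zdot : K).

Local Notation U := (env (schr K n)).

Definition schr_level_rel : set U := [set env_inj schr_z - scal zdot]%classic.

Definition schr_level : Type := alg_quot schr_level_rel.
HB.instance Definition _ := AssocAlg.on schr_level.

Definition schr_cl (u : schr K n) : schr_level :=
  alg_proj schr_level_rel (env_inj u).

End SchrodingerQuotient.

Arguments schr_cl {K n}.

(* Main.v *)
Require Import Defs.
From HB Require Import structures.
From mathcomp Require Import all_boot all_order all_algebra.
From mathcomp Require Import reals complex.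
From mathcomp Require Import finmap monalg ring.

Set Implicit Arguments.
Unset Strict Implicit.
Unset Printing Implicit Defensive.

Import GRing.Theory.
Local Open Scope ring_scope.

(* In any algebra containing x_i, y_i with [x_i, y_j] = delta_ij zdot, quadratic
   expressions in the x_i and y_i give elements omega(g), for g in sl_2 + so_n,
   which act on the span of the x_i and y_i like g and satisfy the same brackets
   as the g.  Hence g |-> g (x) 1 + 1 (x) omega(g), together with the x_i and y_i
   of the Weyl algebra, defines phi.  Conversely, in U(s_n)/<z - zdot> the
   elements g - omega(g) commute with the x_i and y_i, and therefore with every
   omega(g'); so g |-> g - omega(g) again respects brackets and defines, with
   d_i |-> x_i / sqrt zdot and t_i |-> y_i / sqrt zdot, a morphism in the other
   direction.  Both composites are the identity on generators; no PBW theorem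
   is needed. *)

(** * Presentations and universal properties *)

(** Lets a bundled morphism be produced inside a proof, from a map that is itself constructed
    there. *)
Lemma rmorphism_of (A B : pzRingType) (f : A -> B) :
  zmod_morphism f -> monoid_morphism f ->
  exists F : {rmorphism A -> B}, F =1 f.
Proof.
move=> fB fM.
pose F : {rmorphism A -> B} := HB.pack f (GRing.isZmodMorphism.Build A B f fB)
  (GRing.isMonoidMorphism.Build A B f fM).
by exists F.
Qed.

(** * Commutator calculus *)

Section Commutator.
Variable C : pzRingType.
Implicit Types x y z : C.

Definition comm x y := x * y - y * x.

Lemma commDl x y z : comm (x + y) z = comm x z + comm y z.
Proof. by rewrite /comm mulrDl mulrDr opprD addrACA. Qed.

Lemma commDr x y z : comm x (y + z) = comm x y + comm x z.
Proof. by rewrite /comm mulrDl mulrDr opprD addrACA. Qed.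

Lemma commC x y : comm x y = - comm y x.
Proof. by rewrite /comm opprB. Qed.

Lemma commNl x y : comm (- x) y = - comm x y.
Proof. by rewrite /comm mulNr mulrN opprB opprK addrC. Qed.

Lemma commNr x y : comm x (- y) = - comm x y.
Proof. by rewrite /comm mulNr mulrN opprB opprK addrC. Qed.

Lemma commMl x y z : comm (x * y) z = x * comm y z + comm x z * y.
Proof. by rewrite /comm mulrBl mulrBr !mulrA subrKA. Qed.

Lemma commMr x y z : comm x (y * z) = comm x y * z + y * comm x z.
Proof. by rewrite /comm mulrBl mulrBr !mulrA subrKA. Qed.

Lemma comm_suml (I : Type) (r : seq I) (f : I -> C) y :
  comm (\sum_(i <- r) f i) y = \sum_(i <- r) comm (f i) y.
Proof. by rewrite /comm mulr_suml mulr_sumr -sumrB. Qed.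

Lemma comm_sumr (I : Type) (r : seq I) (f : I -> C) x :
  comm x (\sum_(i <- r) f i) = \sum_(i <- r) comm x (f i).
Proof. by rewrite /comm mulr_suml mulr_sumr -sumrB. Qed.

End Commutator.

Section ScalCommutator.
Variables (K : fieldType) (C : assocAlgType K).
Implicit Types (x y : C) (a : K).

Lemma commZl a x y : comm (scal a * x) y = scal a * comm x y.
Proof. by rewrite /comm mulrBr !mulrA (scal_central _ y). Qed.

Lemma commZr a x y : comm x (scal a * y) = scal a * comm x y.
Proof. by rewrite /comm mulrBr !mulrA (scal_central _ x). Qed.

Lemma comm_scall a y : comm (scal a : C) y = 0.
Proof. by rewrite /comm scal_central subrr. Qed.

Lemma comm_scalr a x : comm x (scal a : C) = 0.
Proof. by rewrite /comm scal_central subrr. Qed.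

End ScalCommutator.

Section Presentations.
Variables (K : fieldType) (g : lieAlgType K).

Definition lie_map (A : assocAlgType K) (f : g -> A) : Prop :=
  (forall a u v, f (a *: u + v) = scal a * f u + f v)
  /\ (forall u v, f (lie u v) = comm (f u) (f v)).

Definition alg_map (A B : assocAlgType K) (F : A -> B) : Prop :=
  forall c, F (scal c) = scal c.

(** Phrased as an induction principle, so that identities between morphisms are checked on
    generators. This supplies the uniqueness half of the universal properties; [lie_universal]
    states the existence half. *)
Definition generates (A : assocAlgType K) (X : Type) (f : X -> A) : Prop :=
  forall P : A -> Prop, (forall c, P (scal c)) -> (forall x, P (f x)) ->
  (forall u v, P u -> P v -> P (u + v)) ->
  (forall u v, P u -> P v -> P (u * v)) -> forall u, P u.

(* [R u c] is the relation [i u = c] imposed in addition to those of the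
   enveloping algebra. *)
Definition lie_universal (A : assocAlgType K) (i : g -> A) (R : g -> K -> Prop) : Prop :=
  forall (B : assocAlgType K) (f : g -> B), lie_map f ->
  (forall u c, R u c -> f u = scal c) ->
  exists2 F : {rmorphism A -> B}, alg_map F & forall u, F (i u) = f u.

End Presentations.

Section LieMapTheory.
Variables (K : fieldType) (g : lieAlgType K) (A : assocAlgType K) (f : g -> A).
Hypothesis f_map : lie_map f.

Lemma lie_map_lin a u v : f (a *: u + v) = scal a * f u + f v.
Proof. by case: f_map. Qed.

Lemma lie_map_lie u v : f (lie u v) = comm (f u) (f v).
Proof. by case: f_map. Qed.

Lemma lie_map0 : f 0 = 0.
Proof.
have := lie_map_lin 1 0 0; rewrite scaler0 addr0 rmorph1 mul1r.
by move/(congr1 (fun b => b - f 0)); rewrite subrr addrK => <-.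
Qed.

Lemma lie_mapD u v : f (u + v) = f u + f v.
Proof. by rewrite -[u in LHS]scale1r lie_map_lin rmorph1 mul1r. Qed.

Lemma lie_mapZ a u : f (a *: u) = scal a * f u.
Proof. by rewrite -[a *: u]addr0 lie_map_lin lie_map0 addr0. Qed.

End LieMapTheory.

(** By the Leibniz rule, the elements whose image commutes with [b] form a subalgebra. *)
Lemma generates_comm (K : fieldType) (A B : assocAlgType K) (X : Type) (f : X -> A)
    (F : {rmorphism A -> B}) (b : B) :
  generates f -> alg_map F -> (forall x, comm (F (f x)) b = 0) ->
  forall a, comm (F a) b = 0.
Proof.
move=> gen Fc Ff; apply: gen => [c|x|u v Fu Fv|u v Fu Fv] //.
- by rewrite Fc comm_scall.
- by rewrite raddfD commDl Fu Fv addr0.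
- by rewrite rmorphM commMl Fu Fv mulr0 mul0r addr0.
Qed.

(** * Universal properties of free algebras, quotients and enveloping algebras *)

Section FreeAlgebraLift.
Variables (K : fieldType) (X : choiceType).
Local Notation F := (free_alg K X).

Lemma free_alg_mono (k : word X) (c : K) :
  mkmalgU k c = scal c * \prod_(x <- k) free_gen K x :> F.
Proof.
have -> : \prod_(x <- k) free_gen K x = mkmalgU k 1 :> F.
  elim: k => [|x k IH]; first by rewrite big_nil.
  by rewrite big_cons IH [LHS]fgmulUU mulr1.
by rewrite [RHS]fgmulUU mulr1.
Qed.

Lemma free_alg_generates : generates (@free_gen K X).
Proof.
move=> P Pc Px PD PM u; rewrite [u]monalgE.
have P0 : P 0 by have := Pc 0; rewrite raddf0.
have P1 : P 1 by have := Pc 1; rewrite rmorph1.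
apply: (big_ind P) => // k _; rewrite free_alg_mono; apply: (PM) => //.
exact: (big_ind P).
Qed.

Variables (A : assocAlgType K) (f : X -> A).

Definition free_eval (u : F) : A :=
  \sum_(k <- msupp u) scal (mcoeff k u) * \prod_(x <- k) f x.

(** Extra words have coefficient 0. This allows [u], [v] and [u - v] to be summed over one common
    index set. *)
Lemma free_evalEw (d : {fset word X}) (u : F) : (msupp u `<=` d)%fset ->
  free_eval u = \sum_(k <- d) scal (mcoeff k u) * \prod_(x <- k) f x.
Proof.
move=> le; rewrite /free_eval (big_fset_incl _ le) //= => k kd /mcoeff_outdom ->.
by rewrite raddf0 mul0r.
Qed.

Lemma free_eval_zmod_morphism : zmod_morphism free_eval.
Proof.
move=> u v; set d := (msupp u `|` msupp v `|` msupp (u - v : F))%fset.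
rewrite !(@free_evalEw d) -?sumrB.
- by apply: eq_bigr => k _; rewrite mcoeffB raddfB mulrBl.
- by apply/fsubsetP => k; rewrite !inE => ->; rewrite orbT.
- by apply/fsubsetP => k; rewrite !inE => ->.
- by apply/fsubsetP => k; rewrite !inE => ->; rewrite orbT.
Qed.

HB.instance Definition _ :=
  GRing.isZmodMorphism.Build F A free_eval free_eval_zmod_morphism.

Lemma free_evalU (k : word X) (c : K) :
  free_eval (mkmalgU k c) = scal c * \prod_(x <- k) f x.
Proof. by rewrite (free_evalEw msuppU_le) big_seq_fset1 mcoeffUU. Qed.

Lemma free_eval_monoid_morphism : monoid_morphism free_eval.
Proof.
split; first by rewrite free_evalU big_nil rmorph1 mulr1.
move=> u v; rewrite [u]monalgE [v]monalgE mulr_suml !raddf_sum mulr_suml.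
apply: eq_bigr => k _ /=; rewrite mulr_sumr raddf_sum mulr_sumr.
apply: eq_bigr => l _ /=; rewrite [X in free_eval X]fgmulUU !free_evalU.
by rewrite rmorphM big_cat /= -!mulrA; congr (_ * _); rewrite !mulrA scal_central.
Qed.

Lemma free_alg_lift : exists G : {rmorphism F -> A},
  alg_map G /\ (forall x, G (free_gen K x) = f x).
Proof.
have [G GE] := rmorphism_of free_eval_zmod_morphism free_eval_monoid_morphism.
exists G; split=> [c|x]; rewrite GE free_evalU.
  by rewrite big_nil mulr1.
by rewrite big_seq1 rmorph1 mul1r.
Qed.

End FreeAlgebraLift.

Lemma bquot_lift (R A : pzRingType) (I : biideal R) (F : {rmorphism R -> A}) :
  (forall x, x \in I -> F x = 0) ->
  exists G : {rmorphism bquot I -> A}, forall x, G (bpi I x) = F x.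
Proof.
(* The map is evaluated at a chosen representative; [gE] shows that the choice is immaterial because
   [F] kills [I]. *)
move=> FI; pose g (q : bquot I) : A := F (repr (q : Quotient.quot I)).
have gE x : g (bpi I x) = F x.
  apply/eqP; rewrite -subr_eq0 -raddfB; apply/eqP/FI.
  by rewrite -bpi_eq /bpi reprK.
have [| |G GE] := @rmorphism_of _ _ g.
- move=> p q; have [[x <-] [y <-]] := conj (bpi_surj p) (bpi_surj q).
  by rewrite -raddfB !gE raddfB.
- split=> [|p q]; first by rewrite -[1](rmorph1 (bpi I)) gE rmorph1.
  have [[x <-] [y <-]] := conj (bpi_surj p) (bpi_surj q).
  by rewrite -rmorphM !gE rmorphM.
by exists G => x; rewrite GE.
Qed.

Lemma alg_quot_lift (K : fieldType) (A B : assocAlgType K)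
    (S : classical_sets.set A) (F : {rmorphism A -> B}) :
  alg_map F -> (forall x, S x -> F x = 0) ->
  exists G : {rmorphism alg_quot S -> B},
    alg_map G /\ (forall x, G (alg_proj S x) = F x).
Proof.
move=> Fscal FS; have [|G GE] := @bquot_lift _ _ (ideal_gen S) F.
  move=> x /ideal_genP; elim=> {x} [//||x y _ Fx _ Fy|a x _ Fx|a x _ Fx].
  - exact: raddf0.
  - by rewrite raddfB /= Fx Fy subrr.
  - by rewrite rmorphM Fx mulr0.
  - by rewrite rmorphM Fx mul0r.
by exists G; split=> // c; rewrite [scal c]/(bpi _ (scal c)) GE.
Qed.

(** The hypothesis ranges over every morphism [F] extending [f], so that relations are verified from
    the values on generators alone, without unfolding [free_eval]. *)
Lemma alg_presented_lift (K : fieldType) (X : choiceType)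
    (S : classical_sets.set (free_alg K X)) (A : assocAlgType K) (f : X -> A) :
  (forall F : {rmorphism free_alg K X -> A}, alg_map F ->
     (forall x, F (free_gen K x) = f x) -> forall u, S u -> F u = 0) ->
  exists G : {rmorphism alg_quot S -> A}, alg_map G /\
    (forall x, G (alg_proj S (free_gen K x)) = f x).
Proof.
move=> FS; have [F [Fc Fg]] := free_alg_lift f.
have [G [Gc GE]] := alg_quot_lift Fc (FS F Fc Fg).
by exists G; split=> // x; rewrite GE Fg.
Qed.

Lemma alg_quot_generates (K : fieldType) (A : assocAlgType K)
    (S : classical_sets.set A) (X : Type) (f : X -> A) :
  generates f -> generates (fun x => alg_proj S (f x)).
Proof.
move=> gen P Pc Px PD PM u; have [w <-] := bpi_surj u.
apply: (gen (fun w => P (alg_proj S w))) w => // v w Pv Pw.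
- by rewrite raddfD; apply: PD.
- by rewrite rmorphM; apply: PM.
Qed.

Lemma alg_quot_lie_map (K : fieldType) (g : lieAlgType K) (A : assocAlgType K)
    (S : classical_sets.set A) (f : g -> A) :
  lie_map f -> lie_map (fun u => alg_proj S (f u)).
Proof.
case=> flin flie; split=> [a u v|u v].
  by rewrite flin raddfD /= rmorphM.
by rewrite flie raddfB /= !rmorphM.
Qed.

(** The morphism given by the universal property of [A] kills the generator [i z - scal c] as soon
    as [f z = scal c], which is the one relation recorded at the end. *)
Lemma alg_quot_lie_universal (K : fieldType) (g : lieAlgType K) (A : assocAlgType K)
    (i : g -> A) (z : g) (c : K) :
  lie_universal i (fun _ _ => False) ->
  lie_universal (fun u => alg_proj (fun a => a = i z - scal c) (i u))
    (fun u b => u = z /\ b = c).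
Proof.
move=> univ B f f_lie fz; have [//|F Fc Ff] := univ B f f_lie.
have [|G [Gc GE]] := @alg_quot_lift _ _ _ (fun a => a = i z - scal c) F Fc.
  by move=> _ ->; rewrite raddfB /= Ff Fc (fz z c) ?subrr.
by exists G => // u; rewrite GE Ff.
Qed.

Section EnvelopingAlgebra.
Variables (K : fieldType) (L : lieAlgType K).

Lemma env_generates : generates (@env_inj K L).
Proof. exact: alg_quot_generates (@free_alg_generates K L). Qed.

Lemma env_injP (a : K) (x y : L) :
  env_inj (a *: x + y) = scal a * env_inj x + env_inj y :> env L.
Proof.
have E : scal a * env_inj x + env_inj y =
    alg_proj (@env_rel K L) (scal a * free_gen K x + free_gen K y) :> env L.
  by rewrite raddfD /= rmorphM.
rewrite E; apply/eqP; rewrite [_ == _]bpi_eq; apply/ideal_genP/in_ideal_gen.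
exact: env_rel_linear.
Qed.

Lemma env_inj_lie (x y : L) :
  env_inj (lie x y) = env_inj x * env_inj y - env_inj y * env_inj x :> env L.
Proof.
have E : env_inj x * env_inj y - env_inj y * env_inj x = alg_proj (@env_rel K L)
    (free_gen K x * free_gen K y - free_gen K y * free_gen K x) :> env L.
  by rewrite raddfB /= !rmorphM.
rewrite E; apply/esym/eqP; rewrite [_ == _]bpi_eq.
exact/ideal_genP/in_ideal_gen/env_rel_lie.
Qed.

Lemma env_inj_lie_map : lie_map (@env_inj K L).
Proof. by split=> [a u v|u v]; [exact: env_injP | exact: env_inj_lie]. Qed.

Lemma env_inj_universal : lie_universal (@env_inj K L) (fun _ _ => False).
Proof.
move=> A f [flin flie] _; have [|G [Gc Gf]] := @alg_presented_lift K _ (@env_rel K L) A f.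
  move=> F Fc Fg _ [a x y|x y].
    by rewrite raddfB raddfD /= rmorphM Fc !Fg flin subrr.
  by rewrite !raddfB /= !rmorphM !Fg flie subrr.
by exists G.
Qed.

End EnvelopingAlgebra.

Lemma free_commutatorE (K : fieldType) (X : choiceType) (A : assocAlgType K)
    (F : {rmorphism free_alg K X -> A}) (f : X -> A) (x y : X) :
  (forall x, F (free_gen K x) = f x) ->
  F (free_gen K x * free_gen K y - free_gen K y * free_gen K x)
  = f x * f y - f y * f x.
Proof. by move=> Ff; rewrite raddfB /= !rmorphM !Ff. Qed.

(** * Presentation of the Weyl algebra *)

Section WeylAlgebraPresentation.
Variables (K : fieldType) (n : nat).
Local Notation D := (weyl K n).
Local Notation pi := (alg_proj (@weyl_rel K n)).

Lemma weyl_generates : generates (fun k : 'I_n + 'I_n =>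
  match k with inl i => weyl_t i | inr i => weyl_d i end : D).
Proof.
move=> P Pc Pk; apply: (alg_quot_generates (@free_alg_generates K _)) => // -[i|i].
  exact: (Pk (inl i)).
exact: (Pk (inr i)).
Qed.

Lemma weyl_relE (u v w : free_alg K ('I_n + 'I_n)%type) :
  weyl_rel (u * v - v * u - w) ->
  pi u * pi v - pi v * pi u = pi w :> D.
Proof.
move=> Huv; rewrite -!rmorphM -raddfB; apply/eqP; rewrite [_ == _]bpi_eq.
exact/ideal_genP/in_ideal_gen.
Qed.

Lemma weyl_dd i j : weyl_d i * weyl_d j - weyl_d j * weyl_d i = 0 :> D.
Proof.
have := @weyl_relE (free_gen K (inr i)) (free_gen K (inr j)) 0.
rewrite subr0 raddf0; apply; exact: weyl_rel_dd.
Qed.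

Lemma weyl_tt i j : weyl_t i * weyl_t j - weyl_t j * weyl_t i = 0 :> D.
Proof.
have := @weyl_relE (free_gen K (inl i)) (free_gen K (inl j)) 0.
rewrite subr0 raddf0; apply; exact: weyl_rel_tt.
Qed.

Lemma weyl_dt i j : weyl_d i * weyl_t j - weyl_t j * weyl_d i = (i == j)%:R :> D.
Proof.
by rewrite /weyl_t /weyl_d (weyl_relE (weyl_rel_dt K i j)) rmorph_nat.
Qed.

Lemma weyl_lift (A : assocAlgType K) (d t : 'I_n -> A) :
  (forall i j, d i * d j - d j * d i = 0) ->
  (forall i j, t i * t j - t j * t i = 0) ->
  (forall i j, d i * t j - t j * d i = (i == j)%:R) ->
  exists G : {rmorphism D -> A}, [/\ alg_map G,
    forall i, G (weyl_d i) = d i & forall i, G (weyl_t i) = t i].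
Proof.
move=> dd tt dt.
pose f (k : 'I_n + 'I_n) := match k with inl i => t i | inr i => d i end.
have [|G [Gc Gg]] := @alg_presented_lift K _ (@weyl_rel K n) A f.
  (* The index type in [weyl_rel] hides a [reverse_coercion] on which the
     unification of the rewriting lemmas diverges. *)
  rewrite /reverse_coercion => F Fc Fg _ [i j|i j|i j].
  - exact: etrans (free_commutatorE (inr i) (inr j) Fg) (dd i j).
  - exact: etrans (free_commutatorE (inl i) (inl j) Fg) (tt i j).
  - rewrite raddfB /= rmorph_nat; apply/eqP; rewrite subr_eq0; apply/eqP.
    exact: etrans (free_commutatorE (inr i) (inl j) Fg) (dt i j).
exists G; split=> [c|i|i]; [exact: Gc | exact: (Gg (inr i)) | exact: (Gg (inl i))].
Qed.

End WeylAlgebraPresentation.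

(** Both sides of multiplicativity are biadditive, so they need only be compared on basis elements,
    where [hM] applies. *)
Lemma mr_lin_rmorphism (M A : pzRingType) (h : M -> A) :
  h 1 = 1 -> {morph h : x y / x * y} -> monoid_morphism (mr_lin h).
Proof.
move=> h1 hM; split; first by rewrite mr_lin_of.
move=> x y; elim/monring_ind: x => [|x1 x2 IH1 IH2|k].
- by rewrite !(mul0r, raddf0).
- by rewrite mulrBl !raddfB /= mulrBl IH1 IH2.
elim/monring_ind: y => [|y1 y2 IH1 IH2|l].
- by rewrite !(mulr0, raddf0).
- by rewrite mulrBr !raddfB /= mulrBr IH1 IH2.
by rewrite -mr_ofM !mr_lin_of.
Qed.

(** * The two factors of a tensor product and its universal property *)

Section TensorFactors.
Variables (K : fieldType) (A B : assocAlgType K).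

Definition tens_left (a : A) : tensor A B := a \ox 1.
Definition tens_right (b : B) : tensor A B := 1 \ox b.

Lemma tens_left_zmod_morphism : zmod_morphism tens_left.
Proof.
by move=> a a'; apply/eqP; rewrite eq_sym subr_eq -tensDl subrK.
Qed.

Lemma tens_left_monoid_morphism : monoid_morphism tens_left.
Proof. by split=> [|a a']; rewrite /tens_left ?tens11 // -tensM mulr1. Qed.

Lemma tens_right_zmod_morphism : zmod_morphism tens_right.
Proof.
by move=> b b'; apply/eqP; rewrite eq_sym subr_eq -tensDr subrK.
Qed.

Lemma tens_right_monoid_morphism : monoid_morphism tens_right.
Proof. by split=> [|b b']; rewrite /tens_right ?tens11 // -tensM mulr1. Qed.

HB.instance Definition _ := GRing.isZmodMorphism.Build A (tensor A B) tens_left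
  tens_left_zmod_morphism.
HB.instance Definition _ := GRing.isMonoidMorphism.Build A (tensor A B) tens_left
  tens_left_monoid_morphism.
HB.instance Definition _ := GRing.isZmodMorphism.Build B (tensor A B) tens_right
  tens_right_zmod_morphism.
HB.instance Definition _ := GRing.isMonoidMorphism.Build B (tensor A B) tens_right
  tens_right_monoid_morphism.

Lemma tens_left_scal (c : K) : tens_left (scal c) = scal c.
Proof. by []. Qed.

Lemma tens_right_scal (c : K) : tens_right (scal c) = scal c.
Proof. by rewrite /tens_right -[scal c]mulr1 -tens_scal mulr1. Qed.

Lemma tens_left_right (a : A) (b : B) : tens_left a * tens_right b = a \ox b.
Proof. by rewrite -tensM mulr1 mul1r. Qed.

Lemma tens_left_right_comm (a : A) (b : B) : comm (tens_left a) (tens_right b) = 0.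
Proof. by rewrite /comm -!tensM !mulr1 !mul1r subrr. Qed.

Lemma tensor_generates : generates (fun k : A + B =>
  match k with inl a => tens_left a | inr b => tens_right b end).
Proof.
move=> P Pc Px PD PM; elim/tensor_ind => [|u v Pu Pv|a b].
- by have := Pc 0; rewrite raddf0.
(* [tensor_ind] asks for differences while [P] is closed under sums and products; the scalar -1
   bridges the two. *)
- have -> : u - v = u + scal (-1) * v by rewrite rmorphN1 mulN1r.
  by apply: (PD) => //; apply: PM.
- by rewrite -tens_left_right; apply: PM; [exact: (Px (inl a)) | exact: (Px (inr b))].
Qed.

(** Since the images commute, [(a, b) |-> f a * g b] is multiplicative. It extends additively to the
    monoid ring of [A * B], and the extension kills the generators of [tensor_null]. *)
Lemma tensor_universal (C : assocAlgType K)
    (f : {rmorphism A -> C}) (g : {rmorphism B -> C}) :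
  alg_map f -> alg_map g -> (forall a b, comm (f a) (g b) = 0) ->
  exists2 F : {rmorphism tensor A B -> C}, alg_map F &
    (forall a, F (tens_left a) = f a) /\ (forall b, F (tens_right b) = g b).
Proof.
move=> fc gc fg; have fg_comm a b : f a * g b = g b * f a.
  by apply/eqP; rewrite -subr_eq0; apply/eqP; exact: fg.
pose h (p : (A * B)%type) : C := f p.1 * g p.2.
have [||F FE] := @rmorphism_of (monring (A * B)%type) C (mr_lin h).
- exact: mr_lin_zmod_morphism.
- apply: mr_lin_rmorphism => [|[a b] [a' b']]; rewrite /h /=.
    by rewrite !rmorph1 mulr1.
  by rewrite !rmorphM !mulrA -(mulrA (f a)) fg_comm !mulrA.
have [|G GE] := @bquot_lift _ _ (@tensor_null_pred K A B) F.
  move=> x /tensor_nullP; elim=> {x} [|x y _ Fx _ Fy|a a' b|a b b'|c a b].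
  - exact: raddf0.
  - by rewrite raddfB /= Fx Fy subrr.
  - by rewrite !raddfB /= !FE !mr_lin_of /h /= raddfD mulrDl addrAC addrK subrr.
  - by rewrite !raddfB /= !FE !mr_lin_of /h /= raddfD mulrDr addrAC addrK subrr.
  - rewrite raddfB /= !FE !mr_lin_of /h /= !rmorphM fc gc scal_central.
    by rewrite mulrA subrr.
exists G; first by move=> c; rewrite GE FE mr_lin_of /h /= fc rmorph1 mulr1.
by split=> [a|b]; rewrite GE FE mr_lin_of /h /= rmorph1 ?mulr1 ?mul1r.
Qed.

End TensorFactors.

(** * Quadratic elements over a Heisenberg algebra *)

Section Oscillator.
Variables (K : fieldType) (n : nat).
Local Notation V := 'M[K]_(n, 2).
Local Notation g := (sl2 K * so K n)%type.
Local Notation dX i := (delta_mx i 0 : V).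
Local Notation dY i := (delta_mx i 1 : V).
Implicit Types (u v w : V) (x y : g) (i j : 'I_n).

(** The action of sl_2 + so_n on h_n modulo its centre. The identities below are components of those
    of [schr_act_fun], taken at central coordinate 0. *)
Definition gact x v : V := (x.2 : 'M_n) *m v + v *m (x.1 : 'M_2)^T.

Lemma gact_lin x a u v : gact x (a *: u + v) = a *: gact x u + gact x v.
Proof. exact: (congr1 (fun u : heis K n => u.1) (schr_act_linr a x (u, 0) (v, 0))). Qed.

Lemma gact_linl a x y v : gact (a *: x + y) v = a *: gact x v + gact y v.
Proof. exact: (congr1 (fun u : heis K n => u.1) (schr_act_linl a x y (v, 0))). Qed.

Lemma gact_lie x y v : gact (lie x y) v = gact x (gact y v) - gact y (gact x v).
Proof. exact: (congr1 (fun u : heis K n => u.1) (schr_act_lie x y (v, 0))). Qed.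

(** This is the central component of the derivation property: its left side vanishes because the
    action kills z. *)
Lemma gact_form x u v : heis_form (gact x u) v = - heis_form u (gact x v).
Proof.
apply/eqP; rewrite -addr_eq0; apply/eqP/esym.
exact: (congr1 (fun u : heis K n => u.2) (schr_act_der x (u, 0) (v, 0))).
Qed.

HB.instance Definition _ x :=
  GRing.isLinear.Build K V V _ (gact x) (fun a u v => gact_lin x a u v).

Lemma gactZ x a v : gact x (a *: v) = a *: gact x v.
Proof. exact: linearZ. Qed.

Lemma heis_form_Xl i v : heis_form (dX i) v = v i 1.
Proof.
rewrite /heis_form (bigD1 i) //= big1 => [|j /negPf ji]; rewrite !mxE ?ji ?eqxx /=.
  by rewrite mul1r mul0r subr0 addr0.
by rewrite !mul0r subrr.
Qed.

Lemma heis_form_Yl i v : heis_form (dY i) v = - v i 0.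
Proof.
rewrite /heis_form (bigD1 i) //= big1 => [|j /negPf ji]; rewrite !mxE ?ji ?eqxx /=.
  by rewrite mul1r mul0r sub0r addr0.
by rewrite !mul0r subrr.
Qed.

(** For the symplectic form, [dX i] is paired with [dY i], and [dY i] with [- dX i]. Reading
    coordinates through the form makes the invariance [gact_form] applicable to them. *)
Lemma heis_form_basis v :
  v = \sum_i (heis_form (dX i) v *: dY i - heis_form (dY i) v *: dX i).
Proof.
apply/matrixP => i a; rewrite summxE (bigD1 i) //= big1 ?addr0.
  rewrite !mxE heis_form_Xl heis_form_Yl eqxx mulNr opprK /=.
  by case: a => [[|[|a]] lt_a] //=; rewrite mulr0 mulr1 ?add0r ?addr0;
    congr (v _ _); apply: val_inj.
by move=> j /negPf ji; rewrite !mxE [i == j]eq_sym ji /= !mulr0 subrr.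
Qed.

Section Invariant.
Variables (C : assocAlgType K) (B : V -> V -> C).
Hypothesis B_linl : forall a u v w, B (a *: u + v) w = scal a * B u w + B v w.
Hypothesis B_linr : forall a u v w, B w (a *: u + v) = scal a * B w u + B w v.

(* Invariance of the bivector sum_i (y_i (x) x_i - x_i (x) y_i) dual to the
   symplectic form. *)
Lemma symplectic_invariant x :
  \sum_i (B (dY i) (gact x (dX i)) - B (dX i) (gact x (dY i)))
  = - \sum_i (B (gact x (dY i)) (dX i) - B (gact x (dX i)) (dY i)).
Proof.
have Bl0 w : B 0 w = 0.
  have := B_linl 1 0 0 w; rewrite scaler0 addr0 rmorph1 mul1r.
  by move/(congr1 (fun b => b - B 0 w)); rewrite subrr addrK => <-.
have Br0 w : B w 0 = 0.
  have := B_linr 1 0 0 w; rewrite scaler0 addr0 rmorph1 mul1r.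
  by move/(congr1 (fun b => b - B w 0)); rewrite subrr addrK => <-.
have Bexpl u w : B u w =
    \sum_i (scal (heis_form (dX i) u) * B (dY i) w
            - scal (heis_form (dY i) u) * B (dX i) w).
  rewrite {1}[u]heis_form_basis; elim/big_rec2: _ => // i b s _ IH.
  by rewrite -addrA -IH B_linl -scaleNr B_linl raddfN mulNr addrA.
have Bexpr u w : B w u =
    \sum_i (scal (heis_form (dX i) u) * B w (dY i)
            - scal (heis_form (dY i) u) * B w (dX i)).
  rewrite {1}[u]heis_form_basis; elim/big_rec2: _ => // i b s _ IH.
  by rewrite -addrA -IH B_linr -scaleNr B_linr raddfN mulNr addrA.
(* An operator skew for an alternating form gives a symmetric bilinear form. Hence the coefficients
   of the two double sums agree once the indices are exchanged. *)
have sym u v : heis_form u (gact x v) = heis_form v (gact x u).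
  by rewrite heis_formC gact_form opprK.
under eq_bigr do rewrite Bexpr [B _ (gact x (dY _))]Bexpr -sumrB.
under [in RHS]eq_bigr do rewrite Bexpl [B (gact x (dX _)) _]Bexpl -sumrB.
rewrite exchange_big -sumrN; apply: eq_bigr => i _; rewrite -sumrN.
apply: eq_bigr => j _; rewrite !(sym _ (dX i)) !(sym _ (dY i)).
by rewrite !opprB addrACA [RHS]addrACA; congr (_ + _); exact: addrC.
Qed.

End Invariant.

Variable C : assocAlgType K.

Section Definitions.
Variables (p q : 'I_n -> C).

Definition osc_lin v : C := \sum_i (scal (v i 0) * p i + scal (v i 1) * q i).

Lemma osc_linP a u v : osc_lin (a *: u + v) = scal a * osc_lin u + osc_lin v.
Proof.
rewrite /osc_lin mulr_sumr -big_split /=; apply: eq_bigr => i _.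
by rewrite !mxE !raddfD /= !rmorphM !mulrDl mulrDr !mulrA addrACA.
Qed.

Lemma osc_linD u v : osc_lin (u + v) = osc_lin u + osc_lin v.
Proof. by rewrite -[u in LHS]scale1r osc_linP rmorph1 mul1r. Qed.

Lemma osc_lin0 : osc_lin 0 = 0.
Proof.
by rewrite /osc_lin big1 // => i _; rewrite !mxE raddf0 !mul0r addr0.
Qed.

Lemma osc_linZ a u : osc_lin (a *: u) = scal a * osc_lin u.
Proof. by rewrite -[a *: u]addr0 osc_linP osc_lin0 addr0. Qed.

Lemma osc_linN u : osc_lin (- u) = - osc_lin u.
Proof. by rewrite -scaleN1r osc_linZ rmorphN1 mulN1r. Qed.

Lemma osc_linB u v : osc_lin (u - v) = osc_lin u - osc_lin v.
Proof. by rewrite osc_linD osc_linN. Qed.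

Lemma osc_lin_sum (f : 'I_n -> V) :
  osc_lin (\sum_i f i) = \sum_i osc_lin (f i).
Proof. exact: (big_morph _ osc_linD osc_lin0). Qed.

Lemma osc_linX i : osc_lin (dX i) = p i.
Proof.
rewrite /osc_lin (bigD1 i) //= big1 => [|j /negPf ji]; rewrite !mxE ?ji ?eqxx /=.
  by rewrite raddf0 rmorph1 mul1r mul0r !addr0.
by rewrite raddf0 !mul0r addr0.
Qed.

Lemma osc_linY i : osc_lin (dY i) = q i.
Proof.
rewrite /osc_lin (bigD1 i) //= big1 => [|j /negPf ji]; rewrite !mxE ?ji ?eqxx /=.
  by rewrite raddf0 rmorph1 mul1r mul0r add0r addr0.
by rewrite raddf0 !mul0r addr0.
Qed.

(* (1 / 2 zeta) sum_a (x e_a) e^a over a basis (e_a) of the span of the p_i and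
   q_i and its dual basis for the commutator form: p_i is dual to q_i, and - q_i
   to p_i. *)
Definition osc_quad (zeta : K) x : C := scal (2 * zeta)^-1 *
  \sum_i (osc_lin (gact x (dY i)) * p i - osc_lin (gact x (dX i)) * q i).

Lemma osc_quadP zeta a x y :
  osc_quad zeta (a *: x + y) = scal a * osc_quad zeta x + osc_quad zeta y.
Proof.
rewrite /osc_quad mulrA (scal_central a) -mulrA -mulrDr; congr (_ * _).
rewrite mulr_sumr -big_split /=; apply: eq_bigr => i _.
by rewrite !gact_linl !osc_linP !mulrDl mulrBr !mulrA opprD addrACA.
Qed.

Lemma osc_quadN zeta x : osc_quad zeta (- x) = - osc_quad zeta x.
Proof.
rewrite /osc_quad -mulrN -sumrN; congr (_ * _); apply: eq_bigr => i _.
have gN v : gact (- x) v = - gact x v by rewrite /gact /= raddfN mulNmx mulmxN opprD.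
by rewrite !gN !osc_linN !mulNr opprD.
Qed.

(** The oscillator (Weil) representation of s_n, with z acting as [zeta]. *)
Definition osc zeta (u : schr K n) : C :=
  osc_quad zeta u.1 + osc_lin u.2.1 + scal (zeta * (u.2.2 : K)).

Lemma oscP zeta a (u v : schr K n) :
  osc zeta (a *: u + v) = scal a * osc zeta u + osc zeta v.
Proof.
rewrite /osc osc_quadP osc_linP /= mulrDr raddfD /= mulrCA rmorphM !mulrDr.
by rewrite !addrA [LHS](ACl (1 * 3 * 5 * 2 * 4 * 6)).
Qed.

End Definitions.

(** * Commutation relations of the oscillator representation *)

Section Level.
Variables (p q : 'I_n -> C) (zeta : K).
Hypothesis two_neq0 : (2 : K) != 0.
Hypothesis zeta_neq0 : zeta != 0.
Hypothesis comm_pp : forall i j, comm (p i) (p j) = 0.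
Hypothesis comm_qq : forall i j, comm (q i) (q j) = 0.
Hypothesis comm_pq : forall i j, comm (p i) (q j) = scal (zeta * (i == j)%:R).

Local Notation W := (osc_lin p q).
Local Notation om := (osc_quad p q zeta).
Local Notation mu := (osc p q zeta).

Lemma osc_lin_comm u v : comm (W u) (W v) = scal (zeta * heis_form u v).
Proof.
rewrite comm_suml /heis_form mulr_sumr raddf_sum; apply: eq_bigr => i _ /=.
rewrite comm_sumr (bigD1 i) //= big1 => [|j ji].
  rewrite !(commDl, commDr, commZl, commZr) comm_pp comm_qq [comm (q i) _]commC.
  by rewrite comm_pq eqxx mulr1 !(mulr0, add0r, addr0) !mulrN -!rmorphM -raddfB
    [in RHS]mulrBr; congr scal; ring.
rewrite !(commDl, commDr, commZl, commZr) comm_pp comm_qq [comm (q i) _]commC.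
rewrite !comm_pq [i == j]eq_sym !(negPf ji).
by rewrite [zeta * _]mulr0 !(raddf0, mulr0, addr0).
Qed.

(** The Leibniz rule gives two sums, from the right and from the left factors of the quadratic
    terms. By invariance of the form each equals [zeta] times [W (gact x v)], whence the
    normalisation by [2 * zeta]. *)
Lemma osc_quad_lin_comm x v : comm (om x) (W v) = W (gact x v).
Proof.
have W2 w :
    W w = \sum_i (scal (heis_form (dX i) w) * q i - scal (heis_form (dY i) w) * p i).
  rewrite {1}[w]heis_form_basis osc_lin_sum; apply: eq_bigr => i _.
  by rewrite osc_linB !osc_linZ osc_linX osc_linY.
rewrite commZl comm_suml.
have E i : comm (W (gact x (dY i)) * p i - W (gact x (dX i)) * q i) (W v) =
    scal zeta * (W (gact x (heis_form (dX i) v *: dY i - heis_form (dY i) v *: dX i))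
    + (scal (heis_form (dX i) (gact x v)) * q i
       - scal (heis_form (dY i) (gact x v)) * p i)).
  rewrite commDl commNl !commMl.
  rewrite -[comm (p i) _](congr1 (fun a => comm a _) (osc_linX p q i)).
  rewrite -[comm (q i) _](congr1 (fun a => comm a _) (osc_linY p q i)).
  rewrite !osc_lin_comm !gact_form !mulrN !rmorphN !mulNr.
  rewrite (raddfB (gact x)) /= !gactZ osc_linB !osc_linZ.
  rewrite -!(scal_central _ (W _)) !rmorphM !mulrDr !mulrN !mulrA.
  by rewrite /= opprB [LHS]addrACA [RHS]addrACA; congr (_ + _); exact: addrC.
rewrite (eq_bigr _ (fun i _ => E i)) -mulr_sumr big_split /= -W2.
rewrite -osc_lin_sum -raddf_sum -heis_form_basis -mulr2n /= -[W _ *+ 2]mulr_natl.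
rewrite !mulrA -(rmorph_nat (@scal K C) 2) -!rmorphM -mulrA [zeta * _]mulrC mulVf.
  by rewrite rmorph1 mul1r.
by rewrite mulf_neq0.
Qed.

(** The commutator with [om x] is a derivation. On the left factors of [om y] it produces the action
    of x after y; on the right factors, by [symplectic_invariant], minus that of y after x. *)
Lemma osc_quad_comm x y : comm (om x) (om y) = om (lie x y).
Proof.
rewrite {2}/osc_quad commZr comm_sumr; congr (_ * _).
have Wp x' i : comm (om x') (p i) = W (gact x' (dX i)).
  by rewrite -osc_quad_lin_comm osc_linX.
have Wq x' i : comm (om x') (q i) = W (gact x' (dY i)).
  by rewrite -osc_quad_lin_comm osc_linY.
have E i : comm (om x) (W (gact y (dY i)) * p i - W (gact y (dX i)) * q i) =
    (W (gact x (gact y (dY i))) * p i - W (gact x (gact y (dX i))) * q i)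
    + (W (gact y (dY i)) * W (gact x (dX i)) - W (gact y (dX i)) * W (gact x (dY i))).
  rewrite commDr commNr !commMr !osc_quad_lin_comm Wp Wq opprD.
  by rewrite addrACA.
rewrite (eq_bigr _ (fun i _ => E i)) big_split /=.
(* With this [B], the right-factor terms are [B] with x acting in the second slot; invariance moves
   x to the first slot, under [gact y], with a sign. *)
pose B u v := W (gact y u) * W v.
have Bl a u v w : B (a *: u + v) w = scal a * B u w + B v w.
  by rewrite /B linearP osc_linP mulrDl mulrA.
have Br a u v w : B w (a *: u + v) = scal a * B w u + B w v.
  by rewrite /B osc_linP mulrDr !mulrA (scal_central a).
rewrite [X in _ + X](symplectic_invariant Bl Br x) -sumrB.
apply: eq_bigr => i _; rewrite /B !gact_lie !osc_linB osc_linX osc_linY.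
by rewrite !mulrDl !mulNr !opprD !opprK addrACA.
Qed.

(** The quadratic, mixed and linear commutators match the terms of the semidirect bracket [sd_lie];
    the scalar parts commute with everything. *)
Lemma osc_lie (u v : schr K n) : mu (lie u v) = comm (mu u) (mu v).
Proof.
rewrite /osc [lie u v]/(sd_lie u v) /sd_lie /=.
rewrite !(commDl, commDr) !(comm_scall, comm_scalr) !addr0 osc_quad_comm.
rewrite osc_lin_comm osc_quad_lin_comm [comm (W _) (om _)]commC osc_quad_lin_comm.
rewrite -/(gact _ _) -/(gact _ _) osc_linB.
by rewrite add0r subr0 !addrA.
Qed.

End Level.

Definition schr_vec v : schr K n := (0, (v, 0)).

Lemma schr_vecP a u v : schr_vec (a *: u + v) = a *: schr_vec u + schr_vec v.
Proof.
apply: injective_projections => /=; first by rewrite scaler0 addr0.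
by apply: injective_projections => //=; rewrite scaler0 addr0.
Qed.

Lemma schr_lie_vec x v : lie ((x, 0) : schr K n) (schr_vec v) = schr_vec (gact x v).
Proof.
apply: injective_projections => /=; first exact: lie0r.
apply: injective_projections => /=; last by rewrite heis_form0l addr0 subr0.
by rewrite [0 *m 0]mul0mx mul0mx addr0 subr0 add0r.
Qed.

(** * Removing the oscillator part from a morphism on s_n *)

Section Residual.
Variables (zeta : K) (th : schr K n -> C).
Hypothesis two_neq0 : (2 : K) != 0.
Hypothesis zeta_neq0 : zeta != 0.
Hypothesis th_map : lie_map th.
Hypothesis th_z : th schr_z = scal zeta.

Local Notation p := (fun i => th (schr_x i)).
Local Notation q := (fun i => th (schr_y i)).
Local Notation W := (osc_lin p q).
Local Notation om := (osc_quad p q zeta).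

Lemma schr_morph_heis (v : V) (c : K) :
  th (0, (v, c) : heis K n) = W v + scal (zeta * c).
Proof.
have -> : (0, (v, c) : heis K n) = schr_vec v + c *: schr_z :> schr K n.
  apply: injective_projections => /=; first by rewrite scaler0 addr0.
  by apply: injective_projections; rewrite /= ?scaler0 ?addr0 // add0r [RHS]mulr1.
rewrite (lie_mapD th_map) (lie_mapZ th_map) th_z -rmorphM mulrC; congr (_ + _).
have thvD : {morph (fun w => th (schr_vec w)) : u w / u + w >-> u + w}.
  by move=> u w; rewrite -[u in LHS]scale1r schr_vecP scale1r (lie_mapD th_map).
have thv0 : th (schr_vec 0) = 0 by exact: (lie_map0 th_map).
rewrite {1}[v]heis_form_basis (big_morph _ thvD thv0); apply: eq_bigr => i _.
rewrite heis_form_Xl heis_form_Yl scaleNr opprK.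
rewrite schr_vecP (lie_mapD th_map) (lie_mapZ th_map) -[_ *: dX i]addr0.
by rewrite schr_vecP (lie_mapD th_map) (lie_mapZ th_map) thv0 addr0 addrC.
Qed.

Lemma schr_morph_pp i j : comm (p i) (p j) = 0.
Proof. by rewrite -(lie_map_lie th_map) schr_xx (lie_map0 th_map). Qed.

Lemma schr_morph_qq i j : comm (q i) (q j) = 0.
Proof. by rewrite -(lie_map_lie th_map) schr_yy (lie_map0 th_map). Qed.

Lemma schr_morph_pq i j : comm (p i) (q j) = scal (zeta * (i == j)%:R).
Proof.
by rewrite -(lie_map_lie th_map) schr_xy (lie_mapZ th_map) th_z -rmorphM mulrC.
Qed.

Let om_lin := osc_quad_lin_comm two_neq0 zeta_neq0
  schr_morph_pp schr_morph_qq schr_morph_pq.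
Let om_comm := osc_quad_comm two_neq0 zeta_neq0
  schr_morph_pp schr_morph_qq schr_morph_pq.

Definition residual x : C := th (x, 0) - om x.

Lemma residualP a x y : residual (a *: x + y) = scal a * residual x + residual y.
Proof.
rewrite /residual osc_quadP mulrBr opprD addrACA; congr (_ + _).
rewrite -(lie_map_lin th_map); congr th; apply: injective_projections => //=.
by rewrite scaler0 addr0.
Qed.

(** Both [th (x, 0)] and [om x] induce [gact x] on the span of the x_i and y_i, so the two
    contributions cancel. *)
Lemma residual_lin_comm x v : comm (residual x) (W v) = 0.
Proof.
have Wth w : W w = th (0, (w, 0) : heis K n).
  by rewrite schr_morph_heis mulr0 raddf0 addr0.
by rewrite commDl commNl om_lin !Wth -(lie_map_lie th_map) schr_lie_vec subrr.
Qed.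

(** [om y] is a quadratic expression in elements with which [residual x] commutes. *)
Lemma residual_quad_comm x y : comm (residual x) (om y) = 0.
Proof.
rewrite commZr comm_sumr big1 ?mulr0 // => i _.
have rp j : comm (residual x) (th (schr_x j)) = 0.
  by have := residual_lin_comm x (dX j); rewrite osc_linX.
have rq j : comm (residual x) (th (schr_y j)) = 0.
  by have := residual_lin_comm x (dY j); rewrite osc_linY.
by rewrite commDr commNr !commMr !residual_lin_comm rp rq
  !(mul0r, mulr0, addr0) subrr.
Qed.

(** As [residual x] commutes with [om y], the right side is [comm (th (x, 0)) (th (y, 0)) - comm (om
    x) (th (y, 0))]. *)
Lemma residual_lie x y : residual (lie x y) = comm (residual x) (residual y).
Proof.
rewrite {3}/residual commDr commNr residual_quad_comm oppr0 addr0.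
rewrite {2}/residual commDl commNl -(lie_map_lie th_map) [comm (om x) _]commC opprK.
(* [th (y, 0)] and [om y] differ by [residual y], which commutes with [om x]. *)
have -> : comm (th (y, 0)) (om x) = - om (lie x y).
  have := residual_quad_comm y x; rewrite commDl commNl om_comm.
  by move/eqP; rewrite subr_eq0 => /eqP ->; rewrite lieC osc_quadN.
rewrite /residual; congr (th _ - _); apply: injective_projections => //=.
by rewrite lie0l /schr_act_fun /= !mulmx0 !mul0mx addrK.
Qed.

End Residual.

End Oscillator.

(** * Naturality of the oscillator elements under algebra morphisms *)

Section OscillatorMorphism.
Variables (K : fieldType) (n : nat) (C C' : assocAlgType K) (F : {rmorphism C -> C'}).
Variables (p q : 'I_n -> C) (p' q' : 'I_n -> C').
Hypothesis F_scal : forall a, F (scal a) = scal a.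
Hypothesis F_p : forall i, F (p i) = p' i.
Hypothesis F_q : forall i, F (q i) = q' i.

Lemma osc_lin_morph (v : 'M[K]_(n, 2)) : F (osc_lin p q v) = osc_lin p' q' v.
Proof.
rewrite raddf_sum; apply: eq_bigr => i _ /=.
by rewrite raddfD /= !rmorphM !F_scal F_p F_q.
Qed.

Lemma osc_quad_morph zeta x : F (osc_quad p q zeta x) = osc_quad p' q' zeta x.
Proof.
rewrite rmorphM F_scal raddf_sum; congr (_ * _); apply: eq_bigr => i _ /=.
by rewrite raddfB /= !rmorphM !osc_lin_morph F_p F_q.
Qed.

Lemma osc_morph zeta (u : schr K n) : F (osc p q zeta u) = osc p' q' zeta u.
Proof. by rewrite !raddfD /= osc_quad_morph osc_lin_morph F_scal. Qed.

End OscillatorMorphism.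

(** * The action on the basis x_i, y_i *)

Section ActionOnBasis.
Variables (K : fieldType) (n : nat).
Local Notation dX i := (delta_mx i 0 : 'M[K]_(n, 2)).
Local Notation dY i := (delta_mx i 1 : 'M[K]_(n, 2)).
Implicit Types i j k : 'I_n.

(** Transfers the bracket table of s_n to [gact], in place of fresh matrix computations. *)
Lemma gactE (x : (sl2 K * so K n)%type) (u v : 'M[K]_(n, 2)) :
  lie ((x, 0) : schr K n) (schr_vec u) = schr_vec v -> gact x u = v.
Proof. by rewrite schr_lie_vec => /(congr1 (fun w : schr K n => w.2.1)). Qed.

Lemma gact_eX i : gact (sl2_e, 0) (dX i) = 0.
Proof. by apply: gactE; exact: schr_ex. Qed.
Lemma gact_eY i : gact (sl2_e, 0) (dY i) = dX i.
Proof. by apply: gactE; exact: schr_ey. Qed.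
Lemma gact_fX i : gact (sl2_f, 0) (dX i) = dY i.
Proof. by apply: gactE; exact: schr_fx. Qed.
Lemma gact_fY i : gact (sl2_f, 0) (dY i) = 0.
Proof. by apply: gactE; exact: schr_fy. Qed.
Lemma gact_hX i : gact (sl2_h, 0) (dX i) = dX i.
Proof. by apply: gactE; exact: schr_hx. Qed.
Lemma gact_hY i : gact (sl2_h, 0) (dY i) = - dY i.
Proof.
have oppE : schr_vec (- dY i) = - schr_y i :> schr K n.
  by rewrite -[LHS]/(0, (- dY i, 0)) -[RHS]/(- 0, (- dY i, - 0)) !oppr0.
by apply: gactE; rewrite oppE; exact: schr_hy.
Qed.

Lemma gact_s i j k (a : 'I_2) :
  gact (0, so_s i j) (delta_mx k a : 'M[K]_(n, 2))
  = (j == k)%:R *: delta_mx i a - (i == k)%:R *: delta_mx j a.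
Proof.
rewrite /gact /= trmx0 mulmx0 addr0 mulmxBl !mul_delta_mx_cond.
by rewrite -!scaler_nat.
Qed.

End ActionOnBasis.

(** * Explicit oscillator elements for rescaled canonical pairs *)

Section CanonicalPairs.
Variables (K : fieldType) (n : nat) (r : K) (C : assocAlgType K).
Variables (d t : 'I_n -> C).
Hypothesis dd : forall i j, d i * d j - d j * d i = 0.
Hypothesis tt : forall i j, t i * t j - t j * t i = 0.
Hypothesis dt : forall i j, d i * t j - t j * d i = (i == j)%:R.
Local Notation p := (fun i => scal r * d i).
Local Notation q := (fun i => scal r * t i).
Local Notation om := (osc_quad p q (r ^+ 2)).
Implicit Types i j k : 'I_n.

Lemma canonical_pp i j : comm (p i) (p j) = 0.
Proof. by rewrite commZl commZr /comm dd !mulr0. Qed.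

Lemma canonical_qq i j : comm (q i) (q j) = 0.
Proof. by rewrite commZl commZr /comm tt !mulr0. Qed.

Lemma canonical_pq i j : comm (p i) (q j) = scal (r ^+ 2 * (i == j)%:R).
Proof.
by rewrite commZl commZr /comm dt mulrA -rmorphM [RHS]rmorphM rmorph_nat.
Qed.

Lemma scal_mulACA (a b : K) (u v : C) :
  (scal a * u) * (scal b * v) = scal (a * b) * (u * v).
Proof. by rewrite rmorphM !mulrA; congr (_ * _); rewrite -!mulrA (scal_central b). Qed.

Hypothesis two_neq0 : (2 : K) != 0.
Hypothesis r_neq0 : r != 0.

(** The two factors [r] carried by each quadratic monomial cancel the level [r ^+ 2], which leaves
    the coefficient 1/2 of the formulas in the d_i and t_i. *)
Lemma canonical_scalE (S : C) :
  scal (2 * r ^+ 2)^-1 * (scal (r * r) * S) = scal 2^-1 * S.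
Proof.
by rewrite mulrA -rmorphM -expr2 invfM -mulrA mulVf ?mulr1 // expf_neq0.
Qed.

Lemma canonical_e : om (sl2_e, 0) = scal 2^-1 * \sum_i d i ^+ 2.
Proof.
rewrite /osc_quad -canonical_scalE; congr (_ * _).
rewrite mulr_sumr; apply: eq_bigr => i _.
by rewrite gact_eX gact_eY osc_lin0 osc_linX mul0r subr0 scal_mulACA expr2.
Qed.

Lemma canonical_f : om (sl2_f, 0) = - (scal 2^-1 * \sum_i t i ^+ 2).
Proof.
rewrite /osc_quad -canonical_scalE -mulrN; congr (_ * _).
rewrite mulr_sumr -sumrN; apply: eq_bigr => i _.
by rewrite gact_fX gact_fY osc_lin0 osc_linY mul0r sub0r scal_mulACA expr2.
Qed.

Lemma canonical_h :
  om (sl2_h, 0) = - (scal 2^-1 * \sum_i (d i * t i + t i * d i)).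
Proof.
rewrite /osc_quad -canonical_scalE -mulrN; congr (_ * _).
rewrite mulr_sumr -sumrN; apply: eq_bigr => i _.
rewrite gact_hX gact_hY osc_linN osc_linX osc_linY !mulNr !scal_mulACA mulrDr opprD.
by rewrite addrC.
Qed.

Lemma canonical_s i j : om (0, so_s i j) = t i * d j - t j * d i.
Proof.
have E k : osc_lin p q (gact (0, so_s i j) (delta_mx k 1)) * p k
         - osc_lin p q (gact (0, so_s i j) (delta_mx k 0)) * q k =
    ((j == k)%:R * (q i * p k - p i * q k)
     - (i == k)%:R * (q j * p k - p j * q k)).
  rewrite !gact_s !osc_linB !osc_linZ !osc_linX !osc_linY !rmorph_nat.
  move: (j == k)%:R (i == k)%:R => a b.
  rewrite !mulrBl !mulrBr -!mulrA !opprB.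
  by rewrite [LHS]addrACA [RHS]addrACA; congr (_ + _); rewrite addrC.
rewrite /osc_quad (eq_bigr _ (fun k _ => E k)) sumrB.
have S1 a (G : 'I_n -> C) : \sum_k (a == k)%:R * G k = G a.
  rewrite (bigD1 a) //= big1 => [|k /negPf ka]; first by rewrite eqxx mul1r addr0.
  by rewrite eq_sym ka mul0r.
rewrite !S1 !scal_mulACA -!mulrBr canonical_scalE.
(* Putting the d's to the right creates two Kronecker terms, which cancel by symmetry in i and j;
   the factor 2 absorbs the 1/2. *)
have -> : t i * d j - d i * t j - (t j * d i - d j * t i)
    = 2%:R * (t i * d j - t j * d i).
  rewrite -[d i * t j](subrK (t j * d i)) dt -[d j * t i](subrK (t i * d j)) dt.
  rewrite eq_sym mulr_natl mulr2n.
  move: (_%:R) (t i * d j) (t j * d i) => b u v.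
  rewrite !opprD !opprK !addrA.
  by rewrite [LHS](ACl ((2 * 5) * (1 * 3 * 6 * 4))) /= addNr add0r.
by rewrite -(rmorph_nat (@scal K C) 2) mulrA -rmorphM mulVf // rmorph1 mul1r.
Qed.

End CanonicalPairs.

(** * The isomorphism *)

(* The four algebras enter only through their presentations; keeping them
   abstract avoids conversions between nested quotients. *)
Section Assembly.
Variables (K : fieldType) (n : nat) (zdot r : K).
Hypothesis two_neq0 : (2 : K) != 0.
Hypothesis r_neq0 : r != 0.
Hypothesis r2 : r ^+ 2 = zdot.

Variables (L : assocAlgType K) (cl : schr K n -> L).
Hypothesis cl_lie : lie_map cl.
Hypothesis cl_z : cl schr_z = scal zdot.
Hypothesis cl_gen : generates cl.
Hypothesis cl_univ : lie_universal cl (fun u c => u = schr_z /\ c = zdot).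

Variables (U : assocAlgType K) (iota : (so K n * sl2 K)%type -> U).
Hypothesis iota_lie : lie_map iota.
Hypothesis iota_gen : generates iota.
Hypothesis iota_univ : lie_universal iota (fun _ _ => False).

Variables (D : assocAlgType K) (d t : 'I_n -> D).
Hypothesis dd : forall i j, d i * d j - d j * d i = 0.
Hypothesis tt : forall i j, t i * t j - t j * t i = 0.
Hypothesis dt : forall i j, d i * t j - t j * d i = (i == j)%:R.
Hypothesis D_gen : generates
  (fun k : 'I_n + 'I_n => match k with inl i => t i | inr i => d i end).
Hypothesis D_univ : forall (B : assocAlgType K) (d' t' : 'I_n -> B),
  (forall i j, d' i * d' j - d' j * d' i = 0) ->
  (forall i j, t' i * t' j - t' j * t' i = 0) ->
  (forall i j, d' i * t' j - t' j * d' i = (i == j)%:R) ->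
  exists F : {rmorphism D -> B}, [/\ alg_map F,
    forall i, F (d i) = d' i & forall i, F (t i) = t' i].

Variables (T : assocAlgType K) (tl : {rmorphism U -> T}) (tr : {rmorphism D -> T}).
Hypothesis tl_scal : alg_map tl.
Hypothesis tr_scal : alg_map tr.
Hypothesis tl_tr : forall a b, comm (tl a) (tr b) = 0.
Hypothesis T_gen : generates
  (fun k : U + D => match k with inl a => tl a | inr b => tr b end).
Hypothesis T_univ : forall (B : assocAlgType K)
  (f : {rmorphism U -> B}) (h : {rmorphism D -> B}),
  alg_map f -> alg_map h -> (forall a b, comm (f a) (h b) = 0) ->
  exists2 F : {rmorphism T -> B}, alg_map F &
    (forall a, F (tl a) = f a) /\ (forall b, F (tr b) = h b).

Local Notation p := (fun i => scal r * d i).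
Local Notation q := (fun i => scal r * t i).
Local Notation mu := (osc p q zdot).

(* The factors are swapped because [schr] is built on sl2 * so, while U is the
   enveloping algebra of so * sl2. *)
Definition schr_to_tensor (u : schr K n) : T :=
  tl (iota (u.1.2, u.1.1)) + tr (mu u).

Lemma level_neq0 : zdot != 0.
Proof. by rewrite -r2 expf_neq0. Qed.

Lemma mu_lie (u v : schr K n) : mu (lie u v) = comm (mu u) (mu v).
Proof.
apply: osc_lie => // [|i j|i j|i j].
- exact: level_neq0.
- exact: canonical_pp.
- exact: canonical_qq.
- by rewrite -r2; exact: canonical_pq.
Qed.

(** The projection killing h_n followed by [iota], and [mu], both respect brackets. Their images in
    [T] commute by [tl_tr], so the sum respects brackets as well. *)
Lemma schr_to_tensor_lie : lie_map schr_to_tensor.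
Proof.
case: iota_lie => iota_lin iotaL; split=> [a u v|u v]; rewrite /schr_to_tensor.
  rewrite oscP -[(_, _)]/(a *: (u.1.2, u.1.1) + (v.1.2, v.1.1)) iota_lin.
  move: (mu u) (mu v) (iota _) (iota _) => m m' x x'.
  by rewrite !raddfD /= !rmorphM tl_scal tr_scal mulrDr addrACA.
rewrite mu_lie -[((lie u v).1.2, _)]/(lie (u.1.2, u.1.1) (v.1.2, v.1.1)) iotaL.
move: (mu u) (mu v) (iota _) (iota _) => m m' x x'.
rewrite commDl !commDr tl_tr /comm !raddfB /= !rmorphM -!/(comm _ _).
by rewrite [comm (tr _) (tl _)]commC tl_tr oppr0 addr0 add0r.
Qed.

Lemma mu_vec v : mu (schr_vec v) = osc_lin p q v.
Proof.
rewrite /osc /= mulr0 raddf0 addr0.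
have -> : osc_quad p q zdot 0 = 0.
  by have := osc_quadP p q zdot 1 0 0; rewrite scaler0 addr0 rmorph1 mul1r =>
    /(congr1 (fun b => b - osc_quad p q zdot 0)); rewrite subrr addrK => <-.
by rewrite add0r.
Qed.

Lemma schr_to_tensor_x i : schr_to_tensor (schr_x i) = tr (p i).
Proof.
rewrite /schr_to_tensor /= -[(0, 0)]/(0 : so K n * sl2 K)%type (lie_map0 iota_lie).
by rewrite raddf0 add0r -[schr_x i]/(schr_vec _) mu_vec osc_linX.
Qed.

Lemma schr_to_tensor_y i : schr_to_tensor (schr_y i) = tr (q i).
Proof.
rewrite /schr_to_tensor /= -[(0, 0)]/(0 : so K n * sl2 K)%type (lie_map0 iota_lie).
by rewrite raddf0 add0r -[schr_y i]/(schr_vec _) mu_vec osc_linY.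
Qed.

Lemma mu_inl (x : (sl2 K * so K n)%type) : mu (x, 0) = osc_quad p q zdot x.
Proof. by rewrite /osc /= osc_lin0 mulr0 raddf0 !addr0. Qed.

Lemma schr_to_tensor_z : schr_to_tensor schr_z = scal zdot.
Proof.
rewrite /schr_to_tensor /= -[(0, 0)]/(0 : so K n * sl2 K)%type (lie_map0 iota_lie).
(* [mu_vec 0] reduces to the vanishing of [osc_quad] at 0; only the central term remains. *)
have := mu_vec 0; rewrite osc_lin0 /osc /= osc_lin0 mulr0 raddf0 !addr0 mulr1 => ->.
by rewrite raddf0 !add0r tr_scal.
Qed.

Lemma schr_to_tensor_e :
  schr_to_tensor schr_e = tl (iota (0, sl2_e)) + tr (scal 2^-1 * \sum_i d i ^+ 2).
Proof. by rewrite /schr_to_tensor mu_inl -r2 canonical_e. Qed.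

Lemma schr_to_tensor_f :
  schr_to_tensor schr_f = tl (iota (0, sl2_f)) + tr (- (scal 2^-1 * \sum_i t i ^+ 2)).
Proof. by rewrite /schr_to_tensor mu_inl -r2 canonical_f. Qed.

Lemma schr_to_tensor_h :
  schr_to_tensor schr_h
  = tl (iota (0, sl2_h)) + tr (- (scal 2^-1 * \sum_i (d i * t i + t i * d i))).
Proof. by rewrite /schr_to_tensor mu_inl -r2 canonical_h. Qed.

Lemma schr_to_tensor_s i j :
  schr_to_tensor (schr_s i j) = tl (iota (so_s i j, 0)) + tr (t i * d j - t j * d i).
Proof. by rewrite /schr_to_tensor mu_inl -r2 canonical_s. Qed.

Lemma assembly : exists phi : {rmorphism L -> T},
  [/\ bijective phi, alg_map phi & forall u, phi (cl u) = schr_to_tensor u].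
Proof.
have [|phi phi_scal phi_cl] := cl_univ schr_to_tensor_lie.
  by move=> _ _ [-> ->]; exact: schr_to_tensor_z.
(* The inverse on the factor [U]: the residual of [cl], with the two summands swapped back. *)
pose res (x : (so K n * sl2 K)%type) := residual zdot cl (x.2, x.1).
have res_lie : lie_map res.
  split=> [a x y|x y]; rewrite /res.
    by rewrite -residualP.
  by rewrite -residual_lie ?level_neq0.
have [//|FU FU_scal FU_iota] := iota_univ res_lie.
pose xL i := cl (schr_x i); pose yL i := cl (schr_y i).
have clx i j : comm (xL i) (xL j) = 0 by exact: schr_morph_pp.
have cly i j : comm (yL i) (yL j) = 0 by exact: schr_morph_qq.
have clxy i j : comm (xL i) (yL j) = scal (zdot * (i == j)%:R).
  exact: schr_morph_pq.
(* The inverse on [D]: the commutator of the x_i and y_i is [r ^+ 2] times the Kronecker symbol, so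
   dividing each by [r] gives canonical pairs. *)
have [|||FD [FD_scal FD_d FD_t]] := @D_univ L
  (fun i => scal r^-1 * xL i) (fun i => scal r^-1 * yL i).
- by move=> i j; rewrite -/(comm _ _) commZl commZr clx !mulr0.
- by move=> i j; rewrite -/(comm _ _) commZl commZr cly !mulr0.
- move=> i j; rewrite -/(comm _ _) commZl commZr clxy -!rmorphM -r2 expr2.
  by rewrite -!mulrA mulKf // mulKf // rmorph_nat.
(* Induction on generators in each variable in turn reduces this to the residuals commuting with the
   x_i and y_i. *)
have FUD a b : comm (FU a) (FD b) = 0.
  apply: (generates_comm iota_gen) a => // x; rewrite commC; apply/eqP.
  rewrite oppr_eq0; apply/eqP; apply: (generates_comm D_gen) b => // k.
  apply/eqP; rewrite commC oppr_eq0 FU_iota; apply/eqP.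
  have res_lin v : comm (res x) (osc_lin xL yL v) = 0.
    by rewrite residual_lin_comm ?level_neq0.
  case: k => i; rewrite ?FD_d ?FD_t commZr.
    by have := res_lin (delta_mx i 1); rewrite osc_linY => ->; rewrite mulr0.
  by have := res_lin (delta_mx i 0); rewrite osc_linX => ->; rewrite mulr0.
have [psi psi_scal [psi_l psi_r]] := T_univ FU_scal FD_scal FUD.
have rK (A : assocAlgType K) (a : A) : scal r * (scal r^-1 * a) = a.
  by rewrite mulrA -rmorphM divff // rmorph1 mul1r.
(* By naturality both sides are the quadratic element built from the [tr (p i)] and [tr (q i)]. *)
have phi_res x : phi (osc_quad xL yL zdot x) = tr (osc_quad p q zdot x).
  rewrite (osc_quad_morph (p' := fun i => tr (p i)) (q' := fun i => tr (q i))) //.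
  - by rewrite (osc_quad_morph (p' := fun i => tr (p i)) (q' := fun i => tr (q i))).
  - by move=> i; rewrite phi_cl schr_to_tensor_x.
  - by move=> i; rewrite phi_cl schr_to_tensor_y.
exists phi; split=> //; exists psi.
  (* First composite, [psi] after [phi], checked on the generators [cl u]. *)
  apply: cl_gen => [c|u|u v Pu Pv|u v Pu Pv].
  - by rewrite phi_scal psi_scal.
  - rewrite phi_cl /schr_to_tensor raddfD /= psi_l psi_r FU_iota.
    rewrite (osc_morph (p' := xL) (q' := yL)) // => [|i|i]; last 2 first.
    + by rewrite rmorphM FD_scal FD_d rK.
    + by rewrite rmorphM FD_scal FD_t rK.
    (* The quadratic part subtracted in [residual] cancels the one in [osc]; the linear and central
       terms that remain are [cl] of the Heisenberg component. *)
    case: u => [[a s] [v c]]; rewrite /res /residual /osc /= -!addrA addKr.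
    rewrite -(schr_morph_heis cl_lie cl_z) -(lie_mapD cl_lie); congr cl.
    by apply: injective_projections; rewrite /= ?addr0 ?add0r.
  - by rewrite !raddfD /= Pu Pv.
  - by rewrite !rmorphM Pu Pv.
(* Second composite, [phi] after [psi], on each tensor factor and then on its generators. *)
apply: T_gen => [c|k|u v Pu Pv|u v Pu Pv].
- by rewrite psi_scal phi_scal.
- case: k => [a|b]; rewrite ?psi_l ?psi_r.
    move: a; apply: iota_gen => [c|x|u v Pu Pv|u v Pu Pv].
    + by rewrite FU_scal phi_scal tl_scal.
    (* [phi] of the residual is [tl (iota x)] plus an oscillator term, from which [phi_res]
       subtracts the same term. *)
    + rewrite FU_iota /res /residual raddfB /= phi_cl phi_res /schr_to_tensor mu_inl.
      by case: x => a s; rewrite addrK.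
    + by rewrite !raddfD /= Pu Pv.
    + by rewrite !rmorphM Pu Pv.
  move: b; apply: D_gen => [c|[i|i]|u v Pu Pv|u v Pu Pv].
  + by rewrite FD_scal phi_scal tr_scal.
  + by rewrite FD_t rmorphM phi_scal phi_cl schr_to_tensor_y rmorphM tr_scal mulrA
      -rmorphM mulVf // rmorph1 mul1r.
  + by rewrite FD_d rmorphM phi_scal phi_cl schr_to_tensor_x rmorphM tr_scal mulrA
      -rmorphM mulVf // rmorph1 mul1r.
  + by rewrite !raddfD /= Pu Pv.
  + by rewrite !rmorphM Pu Pv.
- by rewrite !raddfD /= Pu Pv.
- by rewrite !rmorphM Pu Pv.
Qed.

End Assembly.

(** * The presentation of U(s_n)/<z - zdot> *)

Section SchrodingerLevel.
Variables (K : fieldType) (n : nat) (zdot : K).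
Local Notation cl := (schr_cl zdot : schr K n -> schr_level n zdot).

Lemma schr_level_lie_map : lie_map cl.
Proof.
exact (@alg_quot_lie_map K (schr K n) (env (schr K n)) (@schr_level_rel K n zdot) _
  (@env_inj_lie_map K (schr K n))).
Qed.

Lemma schr_level_generates : generates cl.
Proof.
exact (@alg_quot_generates K (env (schr K n)) (@schr_level_rel K n zdot) _ _
  (@env_generates K (schr K n))).
Qed.

Lemma schr_level_universal : lie_universal cl (fun u c => u = schr_z /\ c = zdot).
Proof.
exact (@alg_quot_lie_universal K (schr K n) (env (schr K n)) _ schr_z zdot
  (@env_inj_universal K (schr K n))).
Qed.

Lemma schr_level_z : cl schr_z = scal zdot.
Proof. by apply/eqP; rewrite [_ == _]bpi_eq; apply/ideal_genP/in_ideal_gen. Qed.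

End SchrodingerLevel.

Theorem proposition3 (R : realType) (n : nat) (n_gt0 : (0 < n)%N)
    (zdot sqrtz : R[i]) (zdot_neq0 : zdot != 0) (sqrtz_def : sqrtz ^+ 2 = zdot) :
  let U := env (so R[i] n * sl2 R[i])%type in
  let us (a : so R[i] n) : U := env_inj (dsum_inl a) in
  let ul (a : sl2 R[i]) : U := env_inj (dsum_inr a) in
  let T := tensor U (weyl R[i] n) in
  exists phi : {rmorphism schr_level n zdot -> T},
    [/\ bijective phi,
        forall a : R[i], phi (scal a) = scal a,
        forall i : 'I_n, phi (schr_cl zdot (schr_x i)) = 1 \ox weyl_x sqrtz i,
        forall i : 'I_n, phi (schr_cl zdot (schr_y i)) = 1 \ox weyl_y sqrtz i
      & [/\ phi (schr_cl zdot schr_e) = ul sl2_e \ox 1 + 1 \ox weyl_e,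
            phi (schr_cl zdot schr_f) = ul sl2_f \ox 1 + 1 \ox weyl_f,
            phi (schr_cl zdot schr_h) = ul sl2_h \ox 1 + 1 \ox weyl_h
          & forall i j : 'I_n,
              phi (schr_cl zdot (schr_s i j)) =
              us (so_s i j) \ox 1 + 1 \ox weyl_s i j]].
Proof.
move=> U us ul T.
have two_neq0 : (2 : R[i]) != 0 by rewrite Num.Theory.pnatr_eq0.
have r_neq0 : sqrtz != 0 by move: zdot_neq0; rewrite -sqrtz_def expf_eq0.
have [phi] := @assembly R[i] n zdot sqrtz two_neq0 r_neq0 sqrtz_def
  _ _ (@schr_level_lie_map _ n zdot) (@schr_level_z _ n zdot)
  (@schr_level_generates _ n zdot) (@schr_level_universal _ n zdot) _ _
  (@env_inj_lie_map _ (so R[i] n * sl2 R[i])%type) (@env_generates _ _)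
  (@env_inj_universal _ _)
  _ _ _ (@weyl_dd _ n) (@weyl_tt _ n) (@weyl_dt _ n) (@weyl_generates _ n)
  (@weyl_lift _ n) _ _ _ (@tens_left_scal _ _ _) (@tens_right_scal _ _ _)
  (@tens_left_right_comm _ _ _) (@tensor_generates _ _ _) (@tensor_universal _ _ _).
case=> phi_bij phi_scal phi_cl; exists phi; split.
- exact: phi_bij.
- exact: phi_scal.
(* The value [tens_right (scal sqrtz * weyl_d i)] is convertible to [1 \ox weyl_x sqrtz i]; the
   remaining formulas are identified in the same way. *)
- move=> i; apply: etrans (phi_cl _) _.
  by apply: schr_to_tensor_x; exact: env_inj_lie_map.
- move=> i; apply: etrans (phi_cl _) _.
  by apply: schr_to_tensor_y; exact: env_inj_lie_map.
split=> [|||i j]; apply: etrans (phi_cl _) _.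
- exact: schr_to_tensor_e.
- exact: schr_to_tensor_f.
- exact: schr_to_tensor_h.
- by apply: schr_to_tensor_s => //; exact: weyl_dt.
Qed.
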